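(* Let $d\ge1$ and let $E$ be a real $d\times d$ matrix all of whose eigenvalues have positive real parts. Let $$E=P\begin{pmatrix}E_1&&0\\&\ddots&\\0&&E_{m_1+m_2}\end{pmatrix}P^{-1}$$ be a real Jordan reduction of $E$ (as described in the context), where $P$ is a real invertible matrix and $E_\ell$ has size $d_\ell\times d_\ell$, $1\le \ell\le m_1+m_2$. Assume that for each $1\le\ell\le m_1+m_2$ we are given an $(\mathbb{R}^{d_\ell},E_\ell^t)$ pseudo-norm $\tau_\ell$. For $\xi=(\xi_1,\dots,\xi_{m_1+m_2})\in\prod_{\ell=1}^{m_1+m_2}\mathbb{R}^{d_\ell}=\mathbb{R}^d$ define $$\varphi(\xi)=\big(\tau_1^2(\xi_1)+\cdots+\tau_{m_1+m_2}^2(\xi_{m_1+m_2})\big)^{1/2}.$$ Then the function $\rho(\xi)=\varphi(P^t\xi)$, $\xi\in\mathbb{R}^d$, is an $(\mathbb{R}^d,E^t)$ pseudo-norm. Further, for every $H\in(0,\lambda_{\min}(E))$, the function $f=\rho^{-(2H+\mathrm{Tr}(E))}$ is a spectral density, and the Gaussian field with spectral density $f$ has stationary increments and is operator scaling with exponent $E$ and Hurst index $H$.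
   Context: For $a>0$ and a real square matrix $M$, $a^{M}=\exp(M\log a)$. $M^t$ denotes the transpose of $M$. $\lambda_{\min}(E)=\min\{\mathrm{Re}(\lambda):\lambda \text{ eigenvalue of }E\}$. Pseudo-norm: for a real $n\times n$ matrix $M$ whose eigenvalues all have positive real parts, an $(\mathbb{R}^n,M)$ pseudo-norm is a continuous function $\rho:\mathbb{R}^n\to\mathbb{R}$ that is positive on $\mathbb{R}^n\setminus\{0\}$ and satisfies $\rho(a^{M}x)=a\rho(x)$ for all $x\in\mathbb{R}^n$, $a>0$. Real Jordan reduction: any real $d\times d$ matrix can be written as $P\,\mathrm{diag}(E_1,\dots,E_{m_1+m_2})P^{-1}$ with $(m_1,m_2)\in\mathbb{N}\times\mathbb{N}\setminus\{(0,0)\}$, $P$ real invertible, where: for $1\le \ell\le m_1$, $E_\ell$ is either $\lambda_\ell\,\mathrm{Id}$ or the matrix with $\lambda_\ell$ on the diagonal, $1$ on the first superdiagonal and $0$ elsewhere, with $\lambda_\ell\in\mathbb{R}$; for $1\le\ell\le m_2$, $E_{m_1+\ell}$ is either block diagonal with all $2\times2$ diagonal blocks equal to $A_\ell=\begin{pmatrix}\alpha_\ell&\beta_\ell\\-\beta_\ell&\alpha_\ell\end{pmatrix}$, or the block matrix with $2\times 2$ diagonal blocks $A_\ell$, first block-superdiagonal blocks equal to the $2\times2$ identity $I_2$, and $0$ elsewhere, with $(\alpha_\ell,\beta_\ell)\in\mathbb{R}^2$. Spectral density: a positive function $f$ (defined almost everywhere on $\mathbb{R}^d$) with $\int_{\mathbb{R}^d}(1\wedge|\xi|^2)f(\xi)\,d\xi<\infty$.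 The Gaussian field with spectral density $f$ is the centered real Gaussian field $\{X(x)\}_{x\in\mathbb{R}^d}$ with covariance $\mathbb{E}(X(x)X(y))=\mathrm{Re}\int_{\mathbb{R}^d}(e^{i\langle x,\xi\rangle}-1)(e^{-i\langle y,\xi\rangle}-1)f(\xi)\,d\xi$ (the real part is redundant when $f$ is even); i.e. the field with harmonizable representation $\int_{\mathbb{R}^d}(e^{i\langle x,\xi\rangle}-1)f^{1/2}(\xi)\,d\widehat W(\xi)$, with $d\widehat W$ the Fourier transform of white noise. Stationary increments: for every $h\in\mathbb{R}^d$, $\{X(x+h)-X(h)\}_{x}$ and $\{X(x)\}_x$ have the same finite-dimensional distributions. Operator scaling with exponent $E$ and Hurst index $H>0$: for every $a>0$, $\{X(a^Ex)\}_{x\in\mathbb{R}^d}$ and $\{a^HX(x)\}_{x\in\mathbb{R}^d}$ have the same finite-dimensional distributions. *)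

(* Defs.v *)
From HB Require Import structures.
From mathcomp Require Import all_boot all_order all_algebra complex.
From mathcomp Require Import all_classical all_reals all_analysis.

Set Implicit Arguments.
Unset Strict Implicit.
Unset Printing Implicit Defensive.

Import Order.TTheory GRing.Theory Num.Theory.
Import numFieldNormedType.Exports.

Local Open Scope classical_set_scope.
Local Open Scope ring_scope.

Local Open Scope complex_scope.

(* R^n is 'cV[R]_n, with the topology provided by the library (that of the
   sup norm) and the Borel sigma-algebra, generated by the entries. *)

Definition mx_display : measure_display -> measure_display.
Proof. exact. Qed.

Section measurable_matrix.
Context d (T : measurableType d) (m n : nat).

Definition mx_cylinder : set (set 'M[T]_(m, n)) :=
  [set A | exists i j, exists2 B : set T,
     measurable B & A = [set M : 'M[T]_(m, n) | B (M i j)]].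

HB.instance Definition _ := @isMeasurable.Build (mx_display d) 'M[T]_(m, n)
  <<s mx_cylinder >> (@sigma_algebra0 _ setT mx_cylinder)
  (@sigma_algebraC _ mx_cylinder) (@sigma_algebra_bigcup _ setT mx_cylinder).

Lemma measurable_mx_entry i j :
  measurable_fun [set: 'M[T]_(m, n)] (fun M : 'M[T]_(m, n) => M i j).
Proof.
by move=> _ B mB; rewrite setTI; apply: sub_sigma_algebra; exists i, j, B.
Qed.

Lemma measurable_fun_mxP d' (U : measurableType d') (f : U -> 'M[T]_(m, n)) :
  measurable_fun [set: U] f <->
  forall i j, measurable_fun [set: U] (fun u => f u i j).
Proof.
split=> [mf i j|mf].
  by apply: (measurableT_comp (measurable_mx_entry i j)).
apply: (@measurability _ _ _ _ _ _ mx_cylinder) => //.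
move=> _ [_ [i [j [B mB ->]]] <-].
exact: (mf i j measurableT B mB).
Qed.

End measurable_matrix.

Section lebesgue_cV.
Variable R : realType.

Definition cV_cons n (p : R * 'cV[R]_n) : 'cV[R]_n.+1 :=
  col_mx (p.1%:M : 'cV[R]_1) p.2.

Lemma cV_cons0 n (p : R * 'cV[R]_n) : cV_cons p ord0 ord0 = p.1.
Proof.
rewrite /cV_cons; have -> : ord0 = lshift n (ord0 : 'I_1) by exact/val_inj.
by rewrite (@col_mxEu _ 1 n 1) mxE eqxx.
Qed.

Lemma cV_consS n (p : R * 'cV[R]_n) i : cV_cons p (lift ord0 i) ord0 = p.2 i ord0.
Proof.
rewrite /cV_cons; have -> : lift ord0 i = rshift 1 i by exact/val_inj.
by rewrite (@col_mxEd _ 1 n 1).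
Qed.

Lemma measurable_cV_cons n : measurable_fun [set: R * 'cV[R]_n] (@cV_cons n).
Proof.
apply/measurable_fun_mxP => i j; rewrite ord1 {j}.
case: (unliftP ord0 i) => [k ->|->].
  under eq_fun do rewrite cV_consS.
  exact: (measurableT_comp (measurable_mx_entry k ord0)).
by under eq_fun do rewrite cV_cons0; exact: measurable_fst.
Qed.

Section step.
Context n (mu : {sigma_finite_measure set 'cV[R]_n -> \bar R}).

Definition lebesgue_step : set 'cV[R]_n.+1 -> \bar R :=
  pushforward (lebesgue_measure \x mu)%E (@cV_cons n).

Let cV_cons_preimage (A : set 'cV[R]_n.+1) : measurable A ->
  measurable ((@cV_cons n) @^-1` A : set (measurableTypeR R * 'cV[R]_n)).
Proof.
by move=> mA; rewrite -[X in measurable X]setTI; exact: measurable_cV_cons.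
Qed.

Let lebesgue_step0 : lebesgue_step set0 = 0%E.
Proof. by rewrite /lebesgue_step /pushforward preimage_set0 measure0. Qed.

Let lebesgue_step_ge0 A : (0 <= lebesgue_step A)%E.
Proof. by rewrite /lebesgue_step /pushforward measure_ge0. Qed.

Let lebesgue_step_sigma_additive : semi_sigma_additive lebesgue_step.
Proof.
move=> F mF tF mUF; rewrite /lebesgue_step /pushforward preimage_bigcup.
apply: measure_semi_sigma_additive.
- by move=> k; exact: cV_cons_preimage.
- apply/trivIsetP => /= i j _ _ ij; rewrite -preimage_setI.
  by move/trivIsetP : tF => /(_ _ _ _ _ ij) ->//; rewrite preimage_set0.
- by rewrite -preimage_bigcup; exact: cV_cons_preimage.
Qed.

HB.instance Definition _ := isMeasure.Build _ _ _ lebesgue_step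
  lebesgue_step0 lebesgue_step_ge0 lebesgue_step_sigma_additive.

Let lebesgue_step_sigma_finite : sigma_finite setT lebesgue_step.
Proof.
have /sigma_finiteP[F [TF ndF Foo]] := sigma_finiteT (@lebesgue_measure R).
have /sigma_finiteP[G [TG ndG Goo]] := sigma_finiteT mu.
pose g (v : 'cV[R]_n.+1) := (v ord0 ord0, \col_i v (lift ord0 i) ord0).
have gK p : g (cV_cons p) = p.
  rewrite /g cV_cons0; case: p => x v; congr pair.
  by apply/colP => i; rewrite mxE cV_consS.
have mg : measurable_fun [set: 'cV[R]_n.+1] g.
  apply/measurable_fun_pairP; split; first exact: measurable_mx_entry.
  apply/measurable_fun_mxP => i j.
  rewrite (_ : (fun v => _) = fun v : 'cV[R]_n.+1 => v (lift ord0 i) ord0).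
    exact: measurable_mx_entry.
  by apply/funext => v; rewrite /= mxE.
exists (fun k => g @^-1` (F k `*` G k)).
  apply/seteqP; split=> // v _.
  have [i _ Fi] : (\bigcup_i F i) (g v).1 by rewrite -TF.
  have [j _ Gj] : (\bigcup_j G j) (g v).2 by rewrite -TG.
  exists (maxn i j) => //; split.
    by move: Fi; exact/subsetPset/ndF/leq_maxl.
  by move: Gj; exact/subsetPset/ndG/leq_maxr.
move=> k; have [mF Fk] := Foo k; have [mG Gk] := Goo k; split.
  by rewrite -[X in measurable X]setTI; apply: mg => //; exact: measurableX.
rewrite /lebesgue_step /pushforward -comp_preimage.
rewrite (_ : g \o _ = id); last by apply/funext => p; exact: gK.
by rewrite preimage_id product_measure1E// lte_mul_pinfty// ge0_fin_numE.
Qed.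

HB.instance Definition _ := Measure_isSigmaFinite.Build _ _ _
  lebesgue_step lebesgue_step_sigma_finite.
End step.

Fixpoint lebesgue_cV n : {sigma_finite_measure set 'cV[R]_n -> \bar R} :=
  match n with
  | 0 => dirac (0 : 'cV[R]_0)
  | n'.+1 => lebesgue_step (lebesgue_cV n')
  end.

Lemma lebesgue_cV_box n (A : 'I_n -> set R) : (forall i, measurable (A i)) ->
  lebesgue_cV n [set v : 'cV[R]_n | forall i, A i (v i ord0)] =
  (\prod_(i < n) lebesgue_measure (A i))%E.
Proof.
elim: n A => [|n IHn] A mA.
  by rewrite big_ord0 /= diracE mem_set//; case.
rewrite big_ord_recl -IHn//= /lebesgue_step /pushforward.
have mV : measurable
    [set v : 'cV[R]_n | forall i, A (lift ord0 i) (v i ord0)].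
  rewrite (_ : mkset _ = \bigcap_(i in [set: 'I_n])
      ((fun v : 'cV[R]_n => v i ord0) @^-1` A (lift ord0 i))).
    apply: fin_bigcap_measurable => // i _; rewrite -[X in measurable X]setTI.
    exact: measurable_mx_entry.
  by apply/seteqP; split=> v /= Av i; [move=> _|]; exact: Av.
apply: etrans (product_measure1E lebesgue_measure (lebesgue_cV n) (mA ord0) mV).
congr (product_measure1 _ _ _); apply/seteqP; split=> -[x v] /=.
  move=> Av; split; first by have := Av ord0; rewrite cV_cons0.
  by move=> i; have := Av (lift ord0 i); rewrite cV_consS.
move=> [A0 Av] i; case: (unliftP ord0 i) => [k ->|->].
  by rewrite cV_consS.
by rewrite cV_cons0.
Qed.

End lebesgue_cV.

Section matrices.
Variable R : realType.

Definition mxexp n (M : 'M[R]_n) : 'M[R]_n :=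
  limn (series (fun k => (k`!%:R)^-1 *: M ^+ k)).

Definition mxpow (a : R) n (M : 'M[R]_n) : 'M[R]_n := mxexp (ln a *: M).

Definition complex_spectrum n (M : 'M[R]_n) : set R[i] :=
  [set z | eigenvalue (map_mx (real_complex R) M) z].

Definition positive_spectrum n (M : 'M[R]_n) :=
  forall z, complex_spectrum M z -> 0 < complex.Re z.

(* For 0 < n the spectrum is finite and nonempty, so that inf is a minimum. *)
Definition lambda_min n (M : 'M[R]_n) : R :=
  inf [set complex.Re z | z in complex_spectrum M].

Definition pseudo_norm n (M : 'M[R]_n) (rho : 'cV[R]_n -> R) :=
  [/\ positive_spectrum M,
      continuous rho,
      forall x, x != 0 -> 0 < rho x &
      forall x a, 0 < a -> rho (mxpow a M *m x) = a * rho x].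

Definition real_block n (B : 'M[R]_n) :=
  exists lambda : R, B = lambda%:M \/
    B = \matrix_(i, j) (lambda *+ (i == j) + (i.+1 == j :> nat)%:R).

Definition rot_mx (alpha beta : R) : 'M[R]_2 :=
  \matrix_(i, j) (if i == j then alpha else if (i < j)%N then beta else - beta).

Definition complex_block n (B : 'M[R]_n) :=
  exists (alpha beta : R) (k : nat) (kn : (\sum_(i < k) 2 = n)%N),
    B = castmx (kn, kn) (\mxdiag_(i < k) rot_mx alpha beta) \/
    B = castmx (kn, kn) (\mxblock_(i < k, j < k)
          (if i == j then rot_mx alpha beta
           else if i.+1 == j :> nat then 1%:M else 0)).

(* E = P diag(B_0, ..., B_(m1 + m2 - 1)) P^-1 is a real Jordan reduction: the
   first m1 blocks have a real eigenvalue, the last m2 are made of 2 x 2 blocks. *)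
Definition real_jordan_reduction m1 m2 (dim : 'I_(m1 + m2) -> nat)
    (E P : 'M[R]_(\sum_l dim l)) (B : forall l, 'M[R]_(dim l)) :=
  [/\ (0 < m1 + m2)%N /\ (forall l, (0 < dim l)%N),
      P \in unitmx,
      E = P *m (\mxdiag_l B l) *m invmx P,
      forall l : 'I_m1, real_block (B (lshift m2 l)) &
      forall l : 'I_m2, complex_block (B (rshift m1 l))].

End matrices.

Section gaussian_fields.
Variable R : realType.

Definition dotv n (x y : 'cV[R]_n) : R := \sum_i x i ord0 * y i ord0.

Definition expi (t : R) : R[i] := cos t +i* sin t.

Definition cintegral n (g : 'cV[R]_n -> R[i]) : R[i] :=
  (\int[lebesgue_cV R n]_xi complex.Re (g xi)) +i*
  (\int[lebesgue_cV R n]_xi complex.Im (g xi)).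

(* Only the almost everywhere class of f matters. *)
Definition spectral_density n (f : 'cV[R]_n -> R) :=
  [/\ measurable_fun [set: 'cV[R]_n] f,
      {ae lebesgue_cV R n, forall xi, 0 < f xi} &
      (\int[lebesgue_cV R n]_xi (Num.min 1 (dotv xi xi) * f xi)%:E < +oo)%E].

Definition spectral_covariance n (f : 'cV[R]_n -> R) (x y : 'cV[R]_n) : R :=
  complex.Re (cintegral (fun xi =>
    (expi (dotv x xi) - 1) * (expi (- dotv y xi) - 1) * (f xi)%:C)).

Section fields.
Context d (T : measurableType d) (Pr : probability T R) (n : nat).
Implicit Types X Y : 'cV[R]_n -> {RV Pr >-> R}.

(* Constants are Gaussian; normal_prob m 0 is not a Dirac mass in the library. *)
Definition gaussian_rv (Y : T -> R) := exists m s : R, 0 <= s /\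
  forall A, measurable A ->
    Pr (Y @^-1` A) = if s == 0 then dirac m A else normal_prob m s A.

Definition gaussian_field X :=
  forall k (x : 'I_k -> 'cV[R]_n) (c : 'I_k -> R),
    gaussian_rv (fun w => \sum_i c i * X (x i) w).

Definition gaussian_field_with_density X f :=
  [/\ gaussian_field X,
      forall x, ('E_Pr[X x] = 0)%E &
      forall x y, ('E_Pr[X x \* X y] = (spectral_covariance f x y)%:E)%E].

Definition eq_fdd (X Y : 'cV[R]_n -> T -> R) :=
  forall k (x : 'I_k -> 'cV[R]_n) (A : set 'cV[R]_k), measurable A ->
    Pr [set w | A (\col_i X (x i) w)] = Pr [set w | A (\col_i Y (x i) w)].

Definition stationary_increments X :=
  forall h, eq_fdd (fun x w => X (x + h) w - X h w) (fun x => X x).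

Definition operator_scaling X (E : 'M[R]_n) (H : R) :=
  forall a, 0 < a ->
    eq_fdd (fun x => X (mxpow a E *m x)) (fun x w => a `^ H * X x w).

End fields.
End gaussian_fields.

(* Main.v *)
Require Import Defs.
From mathcomp Require Import all_boot all_order all_algebra perm complex.
From mathcomp Require Import all_classical all_reals all_analysis.
From mathcomp Require Import measurable_realfun ring lra.

Set Implicit Arguments.
Unset Strict Implicit.
Unset Printing Implicit Defensive.

Import Order.TTheory GRing.Theory Num.Theory.
Import numFieldNormedType.Exports.

Local Open Scope classical_set_scope.
Local Open Scope ring_scope.

(* Homogeneity of rho reduces, block by block, to that of the tau_l, because
   exp(t E^t) and exp(t diag(E_l^t)) are intertwined by P^t.

   Integrability of f: for H < h < lambda_min(E) a suitable Q = exp(- s E^t) has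
   powers Q^k = O(exp(- s h k)), and Q multiplies rho by exp(- s). The space
   minus the origin is a union of the images under Q^k, k in Z, of a bounded
   shell S_0 of rho. A linear change of variables gives the volume of each
   image, f is comparable there to exp(s k (2 H + Tr E)), and |xi|^2 is at most
   of order exp(- 2 s h k) for k >= 0; both geometric series converge.

   The finite-dimensional laws of a centered Gaussian field are determined by
   its covariance (Cramer-Wold). The covariance of the increments is that of X
   because |exp(i <h, xi>)| = 1, and the one of X(a^E x) is computed by the
   change of variables xi -> a^(E^t) xi. *)

(** * The exponential of a matrix *)

(** [E] need not be diagonalizable, so [exp(- t E^t)] decays at the rate [lambda_min E] only up to
    polynomial factors; the room between [H] and [lambda_min E] absorbs them, which is where [h]
    comes from. One small [s] is fixed and only powers of the resulting [Q] are used, so the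
    first-order expansion of the exponential at 0 yields the whole decay estimate. The exponent
    [2 H + Tr E] is the one for which [Tr E] cancels the Jacobian [det (a^E) = a^(Tr E)]; this
    cancellation serves both the integrals over the shells and the scaling of the covariance. What
    is left on the shells is [exp(- 2 H s k)] far from the origin and [exp(- 2 (h - H) s k)] near
    it: [0 < H] makes the first series converge, [H < h] the second. Cramer-Wold is reached through
    an algebra of bounded functions that contains the cosines and is closed under bounded limits, up
    to all indicators of measurable sets. In dimension one, a centered Gaussian law is determined by
    its scale, which is read off from the variance. *)

Lemma cvg_sumr (R : realType) (T I : Type) (F : set_system T) (FF : Filter F)
    (r : seq I) (f : I -> T -> R) (a : I -> R) :
  (forall i, f i x @[x --> F] --> a i) ->
  \sum_(i <- r) f i x @[x --> F] --> \sum_(i <- r) a i.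
Proof.
move=> fa; elim: r => [|i r IH].
  by under eq_cvg do rewrite big_nil; rewrite big_nil; exact: cvg_cst.
by under eq_cvg do rewrite big_cons; rewrite big_cons; exact: cvgD.
Qed.

Section matrix_limits.
Variables (R : realType) (m n : nat).

Lemma cvg_mxP (T : Type) (F : set_system T) (FF : Filter F)
    (f : T -> 'M[R]_(m, n)) (M : 'M[R]_(m, n)) :
  f @ F --> M <-> forall i j, (fun x => f x i j) @ F --> M i j.
Proof.
split=> [fM i j|fM].
  exact: (cvg_comp f (fun N : 'M[R]_(m, n) => N i j) fM (@coord_continuous R m n i j M)).
move=> A [P MP PA].
have : \forall x \near F, forall i j, P i j (f x i j).
  by apply: filter_forall => i; apply: filter_forall => j; exact: fM (MP i j).
by apply: filterS => x Px; exact: PA.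
Qed.

Lemma mx_entry_le (M : 'M[R]_(m, n)) i j : `|M i j| <= `|M|.
Proof.
by rewrite [leRHS]/Num.Def.normr/= mx_normrE; exact: (le_bigmax _ _ (i, j)).
Qed.

Lemma mx_norm_le (M : 'M[R]_(m, n)) (e : R) : 0 <= e ->
  (forall i j, `|M i j| <= e) -> `|M| <= e.
Proof.
move=> e0 Me; rewrite [leLHS]/Num.Def.normr/= mx_normrE (bigmax_le _ e0)//=.
Qed.

End matrix_limits.

Section mxexp_theory.
Variables (R : realType) (n : nat).
Implicit Types M : 'M[R]_n.

(** The sup norm is not submultiplicative: each product costs a factor [n], which is harmless
    against the factorial. *)
Lemma mx_expr_bound M k i j : `|(M ^+ k) i j| <= (n%:R * `|M|) ^+ k.
Proof.
elim: k i j => [|k IH] i j.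
  by rewrite !expr0 mxE; case: eqP => _; rewrite ?normr1 ?normr0.
rewrite !exprS mxE (le_trans (ler_norm_sum _ _ _))//.
apply: (@le_trans _ _ (\sum_(l < n) `|M| * (n%:R * `|M|) ^+ k)).
  by apply: ler_sum => l _; rewrite normrM ler_pM// mx_entry_le.
by rewrite sumr_const card_ord -[_ *+ n]mulr_natl mulrA.
Qed.

(** Each entry of [mxexp (t *: M)] becomes a scalar power series in [t], so its derivative comes
    from termwise differentiation of real series. *)
Definition mxexp_coef M i j : R^nat := fun k => (k`!%:R)^-1 * (M ^+ k) i j.

Lemma is_cvg_mxexp_coef M i j t : cvgn (pseries (mxexp_coef M i j) t).
Proof.
apply: normed_cvg.
apply: (@series_le_cvg _ _ (exp_coeff (n%:R * `|M| * `|t|))) => [k|k|k|].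
- exact: normr_ge0.
- by rewrite exp_coeff_ge0// !mulr_ge0.
- rewrite /exp_coeff /= /mxexp_coef !normrM normrX exprMn -mulrA mulrC.
  rewrite [X in _ * X <= _]ger0_norm ?invr_ge0//.
  by rewrite ler_pM2r ?invr_gt0 ?ltr0n ?fact_gt0// ler_wpM2r ?exprn_ge0// mx_expr_bound.
exact: is_cvg_series_exp_coeff.
Qed.

Lemma scalemx_expr (t : R) M k : (t *: M) ^+ k = t ^+ k *: M ^+ k.
Proof.
elim: k => [|k IH]; first by rewrite !expr0 scale1r.
by rewrite !exprS IH -!mulmxE -scalemxAl -scalemxAr scalerA.
Qed.

Lemma mxexp_scaleE t M i j :
  mxexp (t *: M) i j = limn (pseries (mxexp_coef M i j) t).
Proof.
pose L := \matrix_(i, j) limn (pseries (mxexp_coef M i j) t).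
suff : (series (fun k => (k`!%:R)^-1 *: (t *: M) ^+ k)) @ \oo --> L.
  by move=> cL; rewrite /mxexp (cvg_lim _ cL) ?mxE//; exact: norm_hausdorff.
apply/cvg_mxP => a b; rewrite mxE.
rewrite (_ : (fun x => _) = pseries (mxexp_coef M a b) t).
  exact: is_cvg_mxexp_coef.
apply/funext => k; rewrite /pseries /series /= summxE.
by apply: eq_bigr => l _; rewrite scalemx_expr !mxE /mxexp_coef mulrCA mulrC.
Qed.

Lemma mxexp_cvg M : (series (fun k => (k`!%:R)^-1 *: M ^+ k)) @ \oo --> mxexp M.
Proof.
apply/cvg_mxP => a b; rewrite -{2}[M]scale1r mxexp_scaleE.
rewrite (_ : (fun x => _) = pseries (mxexp_coef M a b) 1).
  exact: is_cvg_mxexp_coef.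
apply/funext => k; rewrite /pseries /series /= summxE.
by apply: eq_bigr => l _; rewrite !mxE /mxexp_coef expr1n mulr1.
Qed.

Lemma mxexp0 : mxexp (0 : 'M[R]_n) = 1%:M.
Proof.
apply/matrixP => i j; rewrite -(scale0r (0 : 'M[R]_n)) mxexp_scaleE.
(* Only the term of index 0 survives: the partial sums are constant from rank 1 on, while rank 0 is
   the empty sum. *)
apply/cvg_lim => //; rewrite -(cvg_shiftn 1%N).
rewrite (_ : (fun x => _) = cst ((1%:M : 'M[R]_n) i j)); first exact: cvg_cst.
apply/funext => k; rewrite /pseries /series /= addn1 big_nat_recl//= big1 => [|l _].
  by rewrite /mxexp_coef !expr0 fact0 invr1 mul1r mulr1 addr0.
by rewrite expr0n mulr0.
Qed.

(** Since [(k + 1) / (k + 1)! = 1 / k!], the differentiated series is a finite combination of series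
    of the same kind; iterated, this also settles the convergence of the second one. *)
Lemma mxexp_coef_diffs M i j :
  pseries_diffs (mxexp_coef M i j) = fun k => \sum_l M i l * mxexp_coef M l j k.
Proof.
apply/funext => k; rewrite /pseries_diffs /mxexp_coef factS natrM invfM exprS mxE.
rewrite mulrA mulVKf ?pnatr_eq0// mulr_sumr; apply: eq_bigr => l _.
by rewrite mulrCA.
Qed.

Lemma pseries_sum (I : finType) (a : I -> R) (c : I -> R^nat) t :
  (forall l, cvgn (pseries (c l) t)) ->
  pseries (fun k => \sum_l a l * c l k) t @ \oo -->
  \sum_l a l * limn (pseries (c l) t).
Proof.
move=> cc; rewrite (_ : pseries _ t = fun m => \sum_l a l * pseries (c l) t m).
  apply: cvg_sumr => l; apply: cvgMr; exact: cc.
apply/funext => m; rewrite /pseries /series /=.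
under [RHS]eq_bigr do rewrite mulr_sumr.
rewrite exchange_big /=; apply: eq_bigr => k _.
by rewrite mulr_suml; apply: eq_bigr => l _; rewrite mulrA.
Qed.

Lemma is_derive_mxexp M i j (t : R) :
  is_derive t (1 : R) (fun t => mxexp (t *: M) i j) ((M *m mxexp (t *: M)) i j).
Proof.
have -> : (fun t => mxexp (t *: M) i j) = fun t => limn (pseries (mxexp_coef M i j) t).
  by apply/funext => s; rewrite mxexp_scaleE.
have -> : (M *m mxexp (t *: M)) i j = limn (pseries (pseries_diffs (mxexp_coef M i j)) t).
  rewrite mxexp_coef_diffs; apply/esym/cvg_lim => //; rewrite mxE.
  under eq_bigr do rewrite mxexp_scaleE.
  by apply: pseries_sum => l; exact: is_cvg_mxexp_coef.
(* The series and its first two differentiated series must converge at a point of modulus larger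
   than that of [t]. *)
apply: (@pseries_snd_diffs _ _ (`|t| + 1)).
- exact: is_cvg_mxexp_coef.
- rewrite mxexp_coef_diffs; apply/cvg_ex; eexists; apply: pseries_sum => l.
  exact: is_cvg_mxexp_coef.
- rewrite mxexp_coef_diffs.
  have -> : pseries_diffs (fun k => \sum_l M i l * mxexp_coef M l j k) =
      fun k => \sum_l M i l * pseries_diffs (mxexp_coef M l j) k.
    apply/funext => k; rewrite /pseries_diffs mulr_sumr.
    by apply: eq_bigr => l _; rewrite mulrCA.
  apply/cvg_ex; eexists; apply: pseries_sum => l; rewrite mxexp_coef_diffs.
  apply/cvg_ex; eexists; apply: pseries_sum => l'.
  exact: is_cvg_mxexp_coef.
by rewrite [ltRHS]ger0_norm// ltrDl.
Qed.

Lemma trmx_expr M k : (M ^+ k)^T = M^T ^+ k.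
Proof.
elim: k => [|k IH]; first by rewrite !expr0 trmx1.
by rewrite exprS exprSr -!mulmxE trmx_mul IH.
Qed.

Lemma mxexp_tr M : mxexp M^T = (mxexp M)^T.
Proof.
apply/cvg_lim => //; apply/cvg_mxP => i j; rewrite mxE.
have e k : series (fun k => (k`!%:R)^-1 *: M^T ^+ k) k i j =
    series (fun k => (k`!%:R)^-1 *: M ^+ k) k j i.
  by rewrite /series /= !summxE; apply: eq_bigr => l _; rewrite !mxE -trmx_expr mxE.
by under eq_cvg do rewrite e; exact: ((cvg_mxP _ _ _).1 (@mxexp_cvg M) j i).
Qed.

End mxexp_theory.

(* Conjugation and block decomposition are both instances of an intertwining
   [A U = U B]. *)
Lemma mxexp_intertwine (R : realType) (m n : nat) (A : 'M[R]_m) (B : 'M[R]_n)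
    (U : 'M[R]_(m, n)) : A *m U = U *m B -> mxexp A *m U = U *m mxexp B.
Proof.
move=> AU.
have AUk k : A ^+ k *m U = U *m B ^+ k.
  elim: k => [|k IH]; first by rewrite !expr0 mul1mx mulmx1.
  by rewrite [A ^+ _]exprSr [B ^+ _]exprSr -!mulmxE -mulmxA AU mulmxA IH -mulmxA.
have c1 : (fun k => series (fun k => (k`!%:R)^-1 *: A ^+ k) k *m U) @ \oo
   --> mxexp A *m U.
  apply/cvg_mxP => i j; rewrite mxE.
  rewrite (_ : (fun _ => _) = fun k =>
    \sum_l series (fun k => (k`!%:R)^-1 *: A ^+ k) k i l * U l j).
    apply: cvg_sumr => l; apply: cvgMl; exact: ((cvg_mxP _ _ _).1 (@mxexp_cvg _ _ A) i l).
  by apply/funext => k; rewrite mxE.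
have c2 : (fun k => U *m series (fun k => (k`!%:R)^-1 *: B ^+ k) k) @ \oo
   --> U *m mxexp B.
  apply/cvg_mxP => i j; rewrite mxE.
  rewrite (_ : (fun _ => _) = fun k =>
    \sum_l U i l * series (fun k => (k`!%:R)^-1 *: B ^+ k) k l j).
    apply: cvg_sumr => l; apply: cvgMr; exact: ((cvg_mxP _ _ _).1 (@mxexp_cvg _ _ B) l j).
  by apply/funext => k; rewrite mxE.
apply: cvg_unique c1 _ => //; rewrite [X in X @ _](_ : _ =
    (fun k => U *m series (fun k => (k`!%:R)^-1 *: B ^+ k) k))//.
apply/funext => k; rewrite /series /= mulmx_suml mulmx_sumr; apply: eq_bigr => l _.
by rewrite -scalemxAl -scalemxAr AUk.
Qed.

Lemma submxcol_mxexp (R : realType) (p : nat) (dim : 'I_p -> nat) (t : R)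
    (B : forall l, 'M[R]_(dim l)) (x : 'cV[R]_(\sum_l dim l)) l :
  submxcol (mxexp (t *: \mxdiag_l B l) *m x) l = mxexp (t *: B l) *m submxcol x l.
Proof.
(* [U] extracts the rows of block [l], and [B l *m U = U *m \mxdiag_l B l]. *)
pose U : 'M[R]_(dim l, \sum_l dim l) := submxcol 1%:M l.
have UE m (A : 'M[R]_(\sum_l dim l, m)) : U *m A = submxcol A l.
  by rewrite /U submxcol_mul mul1mx.
rewrite -!UE !mulmxA -(mxexp_intertwine (A := t *: B l))//.
rewrite -scalemxAr -scalemxAl; congr (_ *: _).
rewrite [RHS]UE -[\mxdiag_l0 B l0]mulmx1 -[1%:M in RHS]submxcolK.
by rewrite mul_mxdiag_mxcol mxcolK.
Qed.

(** * Jacobi's formula and the determinant of the exponential *)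

Section jacobi.
Variable R : realType.

Lemma is_derive_prod n (f : 'I_n -> R -> R) (df : 'I_n -> R) (x : R) :
  (forall i, is_derive x (1 : R) (f i) (df i)) ->
  is_derive x (1 : R) (fun t => \prod_i f i t)
    (\sum_k \prod_i (if i == k then df i else f i x)).
Proof.
elim: n f df => [|n IH] f df fdf.
  under eq_fun do rewrite big_ord0.
  by rewrite big_ord0; exact: is_derive_cst.
under eq_fun do rewrite big_ord_recl.
have := @is_deriveM _ _ _ _ x 1 _ _ (fdf ord0) (IH _ _ (fun i => fdf (lift ord0 i))).
rewrite -[_ * _]/(fun t => f ord0 t * \prod_(i < n) f (lift ord0 i) t) => h.
apply: is_derive_eq h _.
rewrite big_ord_recl big_ord_recl eqxx addrC; congr (_ + _).
  by rewrite /GRing.scale /= mulrC; congr (_ * _); apply: eq_bigr.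
rewrite /GRing.scale /= mulr_sumr; apply: eq_bigr => k _.
by rewrite big_ord_recl; congr (_ * _); apply: eq_bigr => i _.
Qed.

(* The left-hand side is the derivative of [\det A] along [A' = M *m A]. *)
Lemma det_derivation n (M A : 'M[R]_n) :
  \sum_k \det (\matrix_(i, j) if i == k then (M *m A) i j else A i j) =
  \tr M * \det A.
Proof.
rewrite mulr_suml; apply: eq_bigr => k _.
(* [J] is the identity with row [k] replaced by that of [M]. Its cofactors along row [k] are those
   of the identity, read off from [1 *m \adj 1 = 1], so [\det J = M k k]. *)
pose J : 'M[R]_n := \matrix_(i, j) if i == k then M i j else (i == j)%:R.
have -> : (\matrix_(i, j) if i == k then (M *m A) i j else A i j) = J *m A.
  apply/matrixP => i j; rewrite !mxE; case: (eqVneq i k) => [->|ik].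
    by apply: eq_bigr => l _; rewrite mxE eqxx.
  rewrite (bigD1 i)//= mxE (negbTE ik) eqxx mul1r big1 ?addr0// => l li.
  by rewrite mxE (negbTE ik) eq_sym (negbTE li) mul0r.
rewrite det_mulmx; congr (_ * _).
rewrite (expand_det_row _ k) (bigD1 k)//= big1 => [|l lk].
  rewrite addr0 mxE eqxx.
  have -> : cofactor J k k = cofactor 1%:M k k.
    rewrite /cofactor; congr (_ * \det _); apply/matrixP => i j.
    by rewrite !mxE eq_sym (negbTE (neq_lift _ _)).
  have : (1%:M *m \adj (1%:M : 'M[R]_n)) k k = 1 by rewrite mul_mx_adj det1 mxE eqxx.
  by rewrite mul1mx mxE => ->; rewrite mulr1.
have -> : cofactor J k l = cofactor 1%:M k l.
  rewrite /cofactor; congr (_ * \det _); apply/matrixP => i j.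
  by rewrite !mxE eq_sym (negbTE (neq_lift _ _)).
have : (1%:M *m \adj (1%:M : 'M[R]_n)) l k = 0.
  by rewrite mul_mx_adj det1 mxE (negbTE lk).
by rewrite mul1mx mxE => ->; rewrite mulr0.
Qed.

Lemma is_derive_det n (A : R -> 'M[R]_n) (M : 'M[R]_n) (x : R) :
  (forall i j, is_derive x (1 : R) (fun t => A t i j) ((M *m A x) i j)) ->
  is_derive x (1 : R) (fun t => \det (A t)) (\tr M * \det (A x)).
Proof.
move=> dA; rewrite -det_derivation.
have h (s : 'S_n) : is_derive x (1 : R) (fun t => (-1) ^+ s * \prod_i A t i (s i))
    ((-1) ^+ s * \sum_k \prod_i (if i == k then (M *m A x) i (s i) else A x i (s i))).
  have := is_derive_prod (fun i => dA i (s i)).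
  by move=> /(is_deriveZ ((-1) ^+ s)).
have -> : \sum_k \det (\matrix_(i, j) if i == k then (M *m A x) i j else A x i j) =
   \sum_(s : 'S_n) ((-1) ^+ s *
     \sum_k \prod_i (if i == k then (M *m A x) i (s i) else A x i (s i))).
  rewrite /determinant exchange_big /=; apply: eq_bigr => s _.
  rewrite mulr_sumr; apply: eq_bigr => k _; congr (_ * _).
  by apply: eq_bigr => i _; rewrite mxE.
rewrite /determinant.
have gen (r : seq 'S_n) : is_derive x (1 : R)
    (fun t => \sum_(s <- r) (-1) ^+ s * \prod_i A t i (s i))
    (\sum_(s <- r) ((-1) ^+ s *
     \sum_k \prod_i (if i == k then (M *m A x) i (s i) else A x i (s i)))).
  elim: r => [|s r IH].
    under eq_fun do rewrite big_nil.
    by rewrite big_nil; exact: is_derive_cst.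
  under eq_fun do rewrite big_cons.
  by rewrite big_cons; exact: (is_deriveD (h s) IH).
exact: gen.
Qed.

(** By Jacobi's formula [y t = det (exp (t M))] solves [y' = (tr M) y]; hence [y t * exp (- t tr M)]
    has zero derivative, and its value at 0 is 1. *)
Lemma det_mxexp n (M : 'M[R]_n) : \det (mxexp M) = expR (\tr M).
Proof.
pose g t := \det (mxexp (t *: M)) * expR (- (t * \tr M)).
have dg (t : R) : is_derive t (1 : R) g 0.
  have d1 := is_derive_det (fun i j => is_derive_mxexp M i j t).
  have d2 : is_derive t (1 : R) (fun t => expR (- (t * \tr M)))
      (- \tr M * expR (- (t * \tr M))).
    have d3 : is_derive t (1 : R) (fun t => - (t * \tr M)) (- \tr M).
      rewrite (_ : (fun t => _) = (- \tr M) *: id); last first.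
        by apply/funext => s; rewrite mulrC -mulNr.
      by apply: is_derive_eq (is_deriveZ _ (is_derive_id t 1)) _; rewrite /GRing.scale /= mulr1.
    have := @is_derive1_comp _ expR (fun t => - (t * \tr M)) t _ _ (is_derive_expR _) d3.
    by rewrite /GRing.scale /= mulrC.
  apply: is_derive_eq (is_deriveM d1 d2) _.
  by rewrite /GRing.scale /=; ring.
have := is_derive_0_is_cst 1 0 dg.
rewrite /g scale1r mul1r scale0r mul0r oppr0 expR0 mulr1 mxexp0 det1 expRN => h.
by apply: (mulIf (invr_neq0 (lt0r_neq0 (expR_gt0 (\tr M))))); rewrite h divff ?gt_eqF ?expR_gt0.
Qed.

End jacobi.

(** * Linear changes of variables in Lebesgue integrals *)

Section borel_cV.
Variable R : realType.

(** The sigma-algebra comes from the entries and the topology from the sup norm; they meet because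
    an open set is a countable union of cubes with rational centres and radii [1 / k.+1]. A radius
    below [e / 2] keeps a cube containing [v] inside the ball of radius [e] around [v]. *)
Lemma open_measurable_cV n (U : set 'cV[R]_n) : open U -> measurable U.
Proof.
move=> oU.
pose box (q : 'cV[rat]_n * nat) :=
  [set v : 'cV[R]_n | forall i, ball (ratr (q.1 i ord0) : R) (q.2.+1%:R^-1 : R) (v i ord0)].
pose F q := if pselect (box q `<=` U) then box q else set0.
have -> : U = \bigcup_q F q.
  apply/seteqP; split=> [v Uv|v [q _]]; last first.
    by rewrite /F; case: (pselect (box q `<=` U)) => [qU|?] //=; exact: qU.
  have /nbhs_ballP[e /= e0 eU] : nbhs v U by apply: open_nbhs_nbhs.
  have [k ke] : exists k : nat, k.+1%:R^-1 < e / 2.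
    have e20 : 0 < e / 2 by rewrite divr_gt0.
    have := @cvg_harmonic R; move=> /cvgrPdist_lt/(_ _ e20)[k _ /(_ k (leqnn k))].
    rewrite sub0r normrN ger0_norm ?invr_ge0//.
    by move=> ?; exists k.
  have [q qv] : exists q : 'cV[rat]_n, forall i, ball (v i ord0) (k.+1%:R^-1 : R) (ratr (q i ord0) : R).
    have qi i : exists q : rat, ball (v i ord0) (k.+1%:R^-1 : R) (ratr q : R).
      have [||_ [] /[swap] [[q _ <-]]] := @dense_rat R (ball (v i ord0) (k.+1%:R^-1 : R)).
      - by exists (v i ord0); apply: ballxx; rewrite invr_gt0.
      - exact: ball_open.
      by exists q.
    have [g gP] := choice qi.
    by exists (\col_i g i) => i; rewrite mxE.
  have qU : box (q, k) `<=` U.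
    move=> w qw; apply: eU; split=> // i j; rewrite ord1.
    apply: (@le_ball _ _ _ (k.+1%:R^-1 + k.+1%:R^-1)).
      by rewrite (splitr e) lerD// ltW.
    by apply: ball_triangle (qv i) (qw i).
  exists (q, k) => //; rewrite /F; case: (pselect (box (q, k) `<=` U)) => [?|//] i /=.
  exact/ball_sym/qv.
apply: countable_bigcupT_measurable => [|q]; first exact: countableP.
rewrite /F; case: (pselect (box q `<=` U)) => [?|?] //=.
rewrite (_ : box q = \bigcap_(i in [set: 'I_n])
    ((fun v : 'cV[R]_n => v i ord0) @^-1` ball (ratr (q.1 i ord0) : R) (q.2.+1%:R^-1 : R))).
  apply: fin_bigcap_measurable => // i _; rewrite -[X in measurable X]setTI.
  by apply: measurable_mx_entry => //; exact: measurable_ball.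
by apply/seteqP; split=> v /= bv i; [move=> _|]; exact: bv.
Qed.

Lemma continuous_measurable_cV n (f : 'cV[R]_n -> R) :
  continuous f -> measurable_fun [set: 'cV[R]_n] f.
Proof.
move=> /continuousP cf; apply: (measurability _ (RGenOpens.measurableE R)).
move=> _ [_ [a [b ->] <-]]; rewrite setTI; apply: open_measurable_cV.
exact/cf/interval_open.
Qed.

Lemma measurable_mulmx m n (A : 'M[R]_(m, n)) :
  measurable_fun [set: 'cV[R]_n] (fun v => A *m v).
Proof.
apply/measurable_fun_mxP => i j.
under eq_fun do rewrite mxE.
apply: measurable_sum => k; apply: measurable_funM => //.
exact: measurable_mx_entry.
Qed.

Lemma measurable_addmx n (c : 'cV[R]_n) :
  measurable_fun [set: 'cV[R]_n] (fun v => v + c).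
Proof.
apply/measurable_fun_mxP => i j.
under eq_fun do rewrite mxE.
by apply: measurable_funD => //; exact: measurable_mx_entry.
Qed.

End borel_cV.

Section lebesgue_affine.
Variable R : realType.
Local Notation mu := (@lebesgue_measure R).
Local Open Scope ereal_scope.

(** The rescaled pushforward agrees with Lebesgue measure on half-open intervals. A negative slope
    moves the closed end to the left, which does not change the length. *)
Lemma lebesgue_affine_set (a b : R) (A : set R) : a != 0%R -> measurable A ->
  mu A = `|a|%:E * mu ((fun x => a * x + b)%R @^-1` A).
Proof.
move=> a0 mA.
have mg : measurable_fun [set: R] (fun x : R => a * x + b)%R.
  by apply: measurable_funD => //; apply: measurable_funM.
pose g x : measurableTypeR R := (a * x + b)%R.
have mg' : measurable_fun [set: measurableTypeR R] g by [].
pose m : {measure set (measurableTypeR R) -> \bar R} :=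
  mscale (NngNum (normr_ge0 a))
    (measure_function_pushforward__canonical__measure_function_Measure mu mg').
rewrite (@lebesgue_measure_unique R m)// => _ [[c d] _ <-].
rewrite -[RHS]/(`|a|%:E * mu (g @^-1` `]c, d]%classic)).
have [apos|aneg|a00] := ltgtP 0%R a; last by rewrite -a00 eqxx in a0.
  have -> : g @^-1` `]c, d]%classic =
      `]((c - b) / a)%R, ((d - b) / a)%R]%classic.
    apply/seteqP; split=> x /=; rewrite /g !in_itv/=;
    by rewrite ltr_pdivrMr// ler_pdivlMr// ltrBlDr lerBrDr mulrC.
  rewrite !lebesgue_measure_itv/= !lte_fin ltr_pM2r ?invr_gt0// ltrD2r.
  case: ifPn => cd; last by rewrite mule0.
  rewrite gtr0_norm// -!EFinB -EFinM; congr EFin; field.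
  by rewrite gt_eqF.
have -> : g @^-1` `]c, d]%classic =
    `[((d - b) / a)%R, ((c - b) / a)%R[%classic.
  apply/seteqP; split=> x /=; rewrite /g !in_itv/=;
  by rewrite ltr_ndivlMr// ler_ndivrMr// ltrBlDr lerBrDr mulrC andbC.
rewrite !lebesgue_measure_itv/= !lte_fin ltr_nM2r ?invr_lt0// ltrD2r.
case: ifPn => cd; last by rewrite mule0.
rewrite ltr0_norm// -!EFinB -EFinM; congr EFin; field.
by rewrite lt_eqF.
Qed.

Lemma ge0_lebesgue_affine (a b : R) (f : R -> \bar R) : a != 0%R ->
  measurable_fun setT f -> (forall x, 0 <= f x) ->
  `|a|%:E * \int[mu]_x f (a * x + b)%R = \int[mu]_x f x.
Proof.
move=> a0 mf f0.
pose g x : measurableTypeR R := (a * x + b)%R.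
have mg : measurable_fun [set: measurableTypeR R] g.
  by apply: measurable_funD => //; apply: measurable_funM.
pose m := measure_function_pushforward__canonical__measure_function_Measure mu mg.
have mf' : measurable_fun [set: measurableTypeR R] f by [].
transitivity (\int[mscale (NngNum (normr_ge0 a)) m]_x f x).
  rewrite ge0_integral_mscale//; congr (_ * _).
  by rewrite /m /= ge0_integral_pushforward// preimage_setT.
apply: eq_measure_integral => A mA _.
exact/esym/(lebesgue_affine_set b a0 mA).
Qed.

End lebesgue_affine.

Section lebesgue_linear.
Variable R : realType.
Local Notation mu := (@lebesgue_measure R).
Local Notation muV := (lebesgue_cV R).
Local Open Scope ereal_scope.

Lemma measurable_cV_cons_comp n (f : 'cV[R]_n.+1 -> \bar R) :
  measurable_fun setT f ->
  measurable_fun [set: measurableTypeR R * 'cV[R]_n] (fun p => f (cV_cons p)).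
Proof. by move=> mf; apply: measurableT_comp => //; exact: measurable_cV_cons. Qed.

Lemma ge0_lebesgue_cV_step n (f : 'cV[R]_n.+1 -> \bar R) :
  measurable_fun setT f -> (forall v, 0 <= f v) ->
  \int[muV n.+1]_v f v = \int[mu \x muV n]_p f (cV_cons p).
Proof.
move=> mf f0.
have mc : measurable_fun [set: measurableTypeR R * 'cV[R]_n] (@cV_cons R n).
  exact: measurable_cV_cons.
have := @ge0_integral_pushforward _ _ _ _ R _ mc (mu \x muV n) setT f measurableT mf (fun y _ => f0 y).
by rewrite preimage_setT.
Qed.

Lemma ge0_lebesgue_cV_fubini1 n (f : 'cV[R]_n.+1 -> \bar R) :
  measurable_fun setT f -> (forall v, 0 <= f v) ->
  \int[muV n.+1]_v f v = \int[mu]_x \int[muV n]_v f (cV_cons (x, v)).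
Proof.
move=> mf f0; rewrite ge0_lebesgue_cV_step//.
by rewrite (fubini_tonelli1 (fun p : measurableTypeR R * _ => f (cV_cons p)))//; exact: measurable_cV_cons_comp.
Qed.

Lemma ge0_lebesgue_cV_fubini2 n (f : 'cV[R]_n.+1 -> \bar R) :
  measurable_fun setT f -> (forall v, 0 <= f v) ->
  \int[muV n.+1]_v f v = \int[muV n]_v \int[mu]_x f (cV_cons (x, v)).
Proof.
move=> mf f0; rewrite ge0_lebesgue_cV_fubini1//.
by rewrite (fubini_tonelli (fun p : measurableTypeR R * _ => f (cV_cons p)))//; exact: measurable_cV_cons_comp.
Qed.

Lemma measurable_cV_slice1 n (f : 'cV[R]_n.+1 -> \bar R) x :
  measurable_fun setT f -> measurable_fun [set: 'cV[R]_n] (fun v => f (cV_cons (x, v))).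
Proof.
move=> mf; have := measurable_cV_cons_comp mf.
by move=> /measurableT_comp; apply; exact: measurable_pair1.
Qed.

Lemma measurable_cV_slice2 n (f : 'cV[R]_n.+1 -> \bar R) v :
  measurable_fun setT f -> measurable_fun [set: measurableTypeR R] (fun x => f (cV_cons (x, v))).
Proof.
move=> mf; have := measurable_cV_cons_comp mf.
by move=> /measurableT_comp; apply; exact: measurable_pair2.
Qed.

Lemma cV_consD n x y (u v : 'cV[R]_n) :
  cV_cons ((x + y)%R, (u + v)%R) = (cV_cons (x, u) + cV_cons (y, v))%R.
Proof.
apply/colP => i; rewrite [RHS]mxE.
by case: (unliftP ord0 i) => [k ->|->]; rewrite ?cV_consS ?cV_cons0 ?mxE.
Qed.

Lemma cV_cons_split n (v : 'cV[R]_n.+1) :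
  v = cV_cons (v ord0 ord0, \col_i v (lift ord0 i) ord0).
Proof.
apply/colP => i; case: (unliftP ord0 i) => [k ->|->].
  by rewrite cV_consS mxE.
by rewrite cV_cons0.
Qed.

(** The first coordinate is translated under the inner integral by the one-dimensional case;
    exchanging the integrals of the function shifted by [(0, c1)] then gives access to the induction
    hypothesis. *)
Lemma ge0_lebesgue_cV_translation n (c : 'cV[R]_n) (f : 'cV[R]_n -> \bar R) :
  measurable_fun setT f -> (forall v, 0 <= f v) ->
  \int[muV n]_v f (v + c)%R = \int[muV n]_v f v.
Proof.
elim: n c f => [|n IH] c f mf f0.
  by apply: eq_integral => v _; congr f; apply/colP; case.
rewrite [RHS]ge0_lebesgue_cV_fubini1//.
have mfc : measurable_fun [set: 'cV[R]_n.+1] (fun v => f (v + c)%R).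
  by apply: measurableT_comp => //; exact: measurable_addmx.
rewrite ge0_lebesgue_cV_fubini2//.
pose c0 := c ord0 ord0; pose c1 := \col_i c (lift ord0 i) ord0.
transitivity (\int[muV n]_v \int[mu]_x f (cV_cons (x, (v + c1)%R))).
  apply: eq_integral => v _.
  have := @ge0_lebesgue_affine R 1%R c0 (fun x => f (cV_cons (x, (v + c1)%R))) (oner_neq0 _).
  rewrite normr1 mul1e => <-//; last exact: measurable_cV_slice2.
  apply: eq_integral => x _; congr f.
  by rewrite mul1r cV_consD [in LHS](cV_cons_split c).
have mfg : measurable_fun [set: 'cV[R]_n.+1] (fun w => f (w + cV_cons (0%R, c1))%R).
  by apply: measurableT_comp => //; exact: measurable_addmx.
transitivity (\int[muV n]_v \int[mu]_x f ((cV_cons (x, v)) + cV_cons (0%R, c1))%R).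
  by under eq_integral do under eq_integral do rewrite -[X in (X, _)]addr0 cV_consD.
rewrite -(ge0_lebesgue_cV_fubini2 mfg)// ge0_lebesgue_cV_fubini1//.
apply: eq_integral => x _.
under eq_integral do rewrite -cV_consD addr0.
rewrite (IH c1 (fun v => f (cV_cons (x, v))))//.
exact: measurable_cV_slice1.
Qed.

(** Formulated as a property of the matrix because it is stable under products: it need only be
    checked on the factors given by elimination. *)
Definition changes_variables n (A : 'M[R]_n) := forall f : 'cV[R]_n -> \bar R,
  measurable_fun setT f -> (forall v, 0 <= f v) ->
  `|\det A|%:E * \int[muV n]_v f (A *m v) = \int[muV n]_v f v.

Lemma changes_variables_mul n (A B : 'M[R]_n) :
  changes_variables A -> changes_variables B -> changes_variables (A *m B).
Proof.
move=> cA cB f mf f0; rewrite det_mulmx normrM EFinM -muleA.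
rewrite -(cA f mf f0); congr (_ * _); rewrite -(cB (fun v => f (A *m v)))//.
  by under eq_integral do rewrite -mulmxA.
by apply: measurableT_comp => //; exact: measurable_mulmx.
Qed.

(** With the first coordinate [x] fixed, the map translates the remaining ones by [c *m x%:M]. *)
Lemma changes_variables_lower n (c : 'cV[R]_n) :
  @changes_variables (1 + n) (block_mx 1%:M 0 c 1%:M).
Proof.
move=> f mf f0; rewrite det_lblock !det1 mulr1 normr1 mul1e.
rewrite [RHS]ge0_lebesgue_cV_fubini1//.
rewrite (@ge0_lebesgue_cV_fubini1 n (fun v => f (block_mx 1%:M 0 c 1%:M *m v)))//; last first.
  by apply: measurableT_comp => //; exact: measurable_mulmx.
apply: eq_integral => x _.
rewrite -(ge0_lebesgue_cV_translation (c *m x%:M) (f := fun v => f (cV_cons (x, v))))//.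
  apply: eq_integral => v _; congr f.
  by rewrite /cV_cons /= mul_block_col !mul1mx mul0mx addr0 addrC.
exact: measurable_cV_slice1.
Qed.

(** With the last coordinates [v] fixed, the first one undergoes [x |-> a x + b v], a
    one-dimensional affine substitution; it turns the integrand into [g], that is [f] composed with
    [diag(1, D)], which is handled by the hypothesis on [D]. *)
Lemma changes_variables_upper n (a : R) (b : 'rV[R]_n) (D : 'M[R]_n) :
  a != 0%R -> changes_variables D ->
  @changes_variables (1 + n) (block_mx a%:M b 0 D).
Proof.
move=> a0 cD f mf f0; rewrite det_ublock det_scalar1 normrM EFinM -muleA.
rewrite (@ge0_lebesgue_cV_fubini2 n (fun v => f (block_mx a%:M b 0 D *m v)))//; last first.
  by apply: measurableT_comp => //; exact: measurable_mulmx.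
pose g w := f (@block_mx _ 1 n 1 n 1%:M 0 0 D *m w).
have mg : measurable_fun [set: 'cV[R]_(1 + n)] g.
  by apply: measurableT_comp => //; exact: measurable_mulmx.
have g0 w : 0 <= g w by exact: f0.
have gE x v : g (cV_cons (x, v)) = f (cV_cons (x, D *m v)).
  by rewrite /g /cV_cons mul_block_col mul1mx !mul0mx addr0 add0r.
have inner v : `|a|%:E * \int[mu]_x f (block_mx a%:M b 0 D *m cV_cons (x, v)) =
    \int[mu]_x g (cV_cons (x, v)).
  rewrite -(@ge0_lebesgue_affine R a ((b *m v) ord0 ord0) (fun x => g (cV_cons (x, v))))//.
    congr (_ * _); apply: eq_integral => x _; rewrite gE /cV_cons mul_block_col mul0mx add0r /=.
    congr (f (col_mx _ _)).
    by apply/matrixP => i j; rewrite !ord1 !mxE !eqxx big_ord1 !mxE !mulr1n.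
  exact: measurable_cV_slice2.
have mF : measurable_fun [set: 'cV[R]_n] (fun v => \int[mu]_x f (block_mx a%:M b 0 D *m cV_cons (x, v))).
  apply: (measurable_fun_fubini_tonelli_G (fun p : measurableTypeR R * _ => f (block_mx a%:M b 0 D *m cV_cons p))) => //.
  apply: (@measurable_cV_cons_comp n (fun v => f (block_mx a%:M b 0 D *m v))).
  by apply: measurableT_comp => //; exact: measurable_mulmx.
rewrite muleCA -ge0_integralZl//; last by move=> v _; exact: integral_ge0.
under eq_integral do rewrite inner.
rewrite -(ge0_lebesgue_cV_fubini2 mg)// ge0_lebesgue_cV_fubini1//.
rewrite [RHS]ge0_lebesgue_cV_fubini1// -ge0_integralZl//.
- apply: eq_integral => x _; rewrite -(cD (fun v => f (cV_cons (x, v))))//.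
    by under eq_integral do rewrite gE.
  exact: measurable_cV_slice1.
- apply: (measurable_fun_fubini_tonelli_F (fun p : measurableTypeR R * _ => g (cV_cons p))) => //.
  exact: measurable_cV_cons_comp.
- by move=> x _; apply: integral_ge0.
Qed.

End lebesgue_linear.

Section lebesgue_cV_boxes.
Variable R : realType.
Local Notation mu := (@lebesgue_measure R).
Local Notation muV := (lebesgue_cV R).

Definition cV_box n (A : 'I_n -> set R) := [set v : 'cV[R]_n | forall i, A i (v i ord0)].

Lemma measurable_cV_box n (A : 'I_n -> set R) :
  (forall i, measurable (A i)) -> measurable (cV_box A).
Proof.
move=> mA; rewrite (_ : cV_box A = \bigcap_(i in [set: 'I_n])
    ((fun v : 'cV[R]_n => v i ord0) @^-1` A i)).
  apply: fin_bigcap_measurable => // i _; rewrite -[X in measurable X]setTI.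
  exact: measurable_mx_entry.
by apply/seteqP; split=> v /= Av i; [move=> _|]; exact: Av.
Qed.

Lemma measurable_cV_boxE n : @measurable _ 'cV[R]_n =
  <<s [set S | exists2 A : 'I_n -> set R, (forall i, measurable (A i)) & S = cV_box A] >>.
Proof.
apply/seteqP; split; last first.
  apply: smallest_sub; first exact: sigma_algebra_measurable.
  by move=> _ [A mA ->]; exact: measurable_cV_box.
apply: smallest_sub; first exact: smallest_sigma_algebra.
move=> _ [i [j [B mB ->]]]; apply: sub_sigma_algebra.
exists (fun k => if k == i then B else setT).
  by move=> k; case: ifP => // _.
apply/seteqP; split=> v /=; rewrite ord1.
  by move=> Bv k; case: eqP => [->|].
by move=> /(_ i); rewrite eqxx.
Qed.

Lemma cV_bound n (v : 'cV[R]_n) : exists k : nat, forall i, `|v i ord0| <= k%:R.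
Proof.
exists (Num.truncn `|v|).+1 => i; rewrite (le_trans (mx_entry_le v i ord0))//.
exact/ltW/truncnS_gt.
Qed.

(** Boxes generate the sigma-algebra, are stable under intersection, and the cubes [[-k, k]^n] of
    finite measure exhaust the space. *)
Lemma lebesgue_cV_unique n (m : {measure set 'cV[R]_n -> \bar R}) :
  (forall A : 'I_n -> set R, (forall i, measurable (A i)) ->
    m (cV_box A) = \prod_(i < n) mu (A i))%E ->
  forall S, measurable S -> m S = muV n S.
Proof.
move=> mE.
apply: (measure_unique
  [set S | exists2 A : 'I_n -> set R, (forall i, measurable (A i)) & S = cV_box A]
  (fun k => cV_box (fun=> `[- k%:R, k%:R]%classic))).
- exact: measurable_cV_boxE.
- move=> _ _ [A mA ->] [B mB ->]; exists (fun i => A i `&` B i).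
    by move=> i; exact: measurableI.
  apply/seteqP; split=> v /=; first by move=> [Av Bv] i; split; [exact: Av|exact: Bv].
  by move=> ABv; split=> i; have [] := ABv i.
- by move=> k; exists (fun=> `[- k%:R, k%:R]%classic).
- apply/seteqP; split=> // v _; have [k vk] := cV_bound v.
  by exists k => // i /=; rewrite in_itv/= -ler_norml.
- by move=> _ [A mA ->]; rewrite mE//; exact/esym/lebesgue_cV_box.
- move=> k; rewrite mE//; rewrite -ge0_fin_numE.
    elim/big_ind : _ => //[x y|i _]; first exact: fin_numM.
    by rewrite lebesgue_measure_itv/=; case: ifP.
  by apply: prode_ge0 => i _.
Qed.

(** The pushforward by a permutation only reorders the factors in the volume of a box, so uniqueness
    on boxes applies. *)
Lemma changes_variables_perm n (s : {perm 'I_n}) :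
  changes_variables (perm_mx s : 'M[R]_n).
Proof.
move=> f mf f0; rewrite det_perm normrX normrN1 expr1n mul1e.
have ms : measurable_fun [set: 'cV[R]_n] (fun v => perm_mx s *m v).
  exact: measurable_mulmx.
pose m := measure_function_pushforward__canonical__measure_function_Measure (muV n) ms.
transitivity (\int[m]_v f v)%E.
  by rewrite /m /= ge0_integral_pushforward// preimage_setT.
apply: eq_measure_integral => S mS _; apply: lebesgue_cV_unique => // A mA.
rewrite -[LHS]/(muV n ((fun v => perm_mx s *m v) @^-1` cV_box A)).
have -> : (fun v => perm_mx s *m v) @^-1` cV_box A = cV_box (fun i => A ((s^-1)%g i)).
  apply/seteqP; split=> v /= Av i.
    by have := Av ((s^-1)%g i); rewrite -row_permE mxE permKV.
  by rewrite -row_permE mxE; have := Av (s i); rewrite permK.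
rewrite [LHS](lebesgue_cV_box (fun i => mA _)).
by rewrite (reindex_inj (@perm_inj _ s))/=; apply: eq_bigr => i _; rewrite permK.
Qed.

(** Gaussian elimination, by induction on the size: a column transposition brings a nonzero entry of
    the first row to the corner, and the Schur complement [D - a^-1 *: c *m b] is the smaller
    invertible block. *)
Lemma changes_variables_unitmx n (A : 'M[R]_n) : A \in unitmx -> changes_variables A.
Proof.
elim: n A => [|n IH] A uA.
  move=> f mf f0; rewrite det_mx00 normr1 mul1e.
  by apply: eq_integral => v _; congr f; apply/colP; case.
have [j Aj] : exists j, A ord0 j != 0.
  apply/existsP; apply: contraLR uA; rewrite negb_exists => /forallP A0.
  rewrite unitmxE (expand_det_row _ ord0) big1 ?unitr0// => j _.
  by have := A0 j; rewrite negbK => /eqP ->; rewrite mul0r.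
pose A' : 'M[R]_(1 + n) := A *m tperm_mx ord0 j.
have A00 : A' ord0 ord0 = A ord0 j by rewrite /A' -xcolE mxE tpermL.
have -> : A = A' *m tperm_mx ord0 j.
  rewrite /A' -mulmxA -perm_mxM.
  by rewrite tperm2 perm_mx1 mulmx1.
apply: changes_variables_mul; last exact: changes_variables_perm.
have uA' : A' \in unitmx by rewrite unitmx_mul uA unitmx_perm.
move: A' A00 uA' => A' A00 uA'.
pose a : R := A' ord0 ord0; pose b := ursubmx A'; pose c := dlsubmx A'; pose D := drsubmx A'.
have a0 : a != 0 by rewrite /a A00.
have E : A' = block_mx 1%:M 0 (a^-1 *: c) 1%:M *m block_mx a%:M b 0 (D - a^-1 *: c *m b).
  rewrite mulmx_block !mul1mx !mul0mx !addr0 -scalemxAl mul_mx_scalar scalerA.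
  rewrite mulVf// scale1r addrC subrK -[LHS]submxK; congr block_mx.
  apply/matrixP => i k; rewrite !ord1 !mxE eqxx mulr1n /a.
  by congr (A' _ _); apply/val_inj.
have uD : (D - a^-1 *: c *m b) \in unitmx.
  move: uA'; rewrite E unitmx_mul => /andP[_].
  by rewrite !unitmxE det_ublock unitrM => /andP[_].
rewrite E; apply: changes_variables_mul; first exact: changes_variables_lower.
by apply: changes_variables_upper => //; exact: IH.
Qed.

Lemma lebesgue_cV_preimage n (A : 'M[R]_n) (S : set 'cV[R]_n) :
  A \in unitmx -> measurable S ->
  (`|\det A|%:E * muV n [set v | S (A *m v)] = muV n S)%E.
Proof.
move=> uA mS.
have mA : measurable [set v | S (A *m v)].
  by rewrite -[X in measurable X]setTI; apply: measurable_mulmx.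
have e1 : (\int[muV n]_v (\1_S v)%:E)%E = muV n S by rewrite integral_indic// setIT.
have e2 : (\int[muV n]_v (\1_S (A *m v))%:E)%E = muV n [set v | S (A *m v)].
  by rewrite -[in RHS](setIT [set v | _]) -integral_indic.
rewrite -e1 -e2; apply: (changes_variables_unitmx uA (f := fun v => (\1_S v)%:E)) => //.
exact/measurable_EFinP/measurable_indic.
Qed.

End lebesgue_cV_boxes.

(** * Decay of the exponential *)

Section complex_row_sums.
Variable R : realType.
Local Open Scope complex_scope.
Local Notation C := R[i].
Import ComplexField.Normc.
Local Notation normc := (@normc R).

Lemma normc_ge0 (z : C) : 0 <= normc z.
Proof. by case: z => a b; exact: sqrtr_ge0. Qed.

Lemma normc_real (x : R) : normc x%:C = `|x|.
Proof. by rewrite /ComplexField.Normc.normc/= expr0n addr0 sqrtr_sqr. Qed.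

Lemma le_normc_sum (I : Type) (r : seq I) (f : I -> C) :
  normc (\sum_(i <- r) f i) <= \sum_(i <- r) normc (f i).
Proof.
elim: r => [|i r IH]; first by rewrite !big_nil normc0.
by rewrite !big_cons (le_trans (le_normcD _ _))// lerD2l.
Qed.

(** This bounds the operator norm for the sup norm on [C^n]. Unlike a bound on the entries, it
    multiplies under products with no dimensional factor, so a geometric rate survives in powers. *)
Definition row_sums_le n (r : R) (A : 'M[C]_n) := forall i, \sum_j normc (A i j) <= r.

Lemma row_sums_le_entry n r (A : 'M[C]_n) i j : row_sums_le r A -> normc (A i j) <= r.
Proof.
move=> /(_ i); apply: le_trans; rewrite (bigD1 j)//= lerDl sumr_ge0// => *.
exact: normc_ge0.
Qed.

Lemma row_sums_le_ex n (A : 'M[C]_n) : exists2 r, 0 <= r & row_sums_le r A.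
Proof.
exists (\sum_i \sum_j normc (A i j)).
  by apply: sumr_ge0 => i _; apply: sumr_ge0 => j _; exact: normc_ge0.
move=> i; rewrite [leRHS](bigD1 i)//= lerDl.
by apply: sumr_ge0 => k _; apply: sumr_ge0 => j _; exact: normc_ge0.
Qed.

Lemma row_sums_leD n r s (A B : 'M[C]_n) :
  row_sums_le r A -> row_sums_le s B -> row_sums_le (r + s) (A + B).
Proof.
move=> Ar Bs i; apply: le_trans (lerD (Ar i) (Bs i)); rewrite -big_split.
by apply: ler_sum => j _; rewrite mxE le_normcD.
Qed.

Lemma row_sums_leM n r s (A B : 'M[C]_n) : 0 <= s ->
  row_sums_le r A -> row_sums_le s B -> row_sums_le (r * s) (A *m B).
Proof.
move=> s0 Ar Bs i.
apply: (@le_trans _ _ (\sum_j \sum_l normc (A i l) * normc (B l j))).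
  apply: ler_sum => j _; rewrite mxE (le_trans (le_normc_sum _ _))//.
  by apply: ler_sum => l _; rewrite normcM.
rewrite exchange_big/=.
apply: (@le_trans _ _ (\sum_l normc (A i l) * s)).
  by apply: ler_sum => l _; rewrite -mulr_sumr ler_wpM2l ?normc_ge0.
by rewrite -mulr_suml ler_wpM2r.
Qed.

Lemma row_sums_leX n r (A : 'M[C]_n) k : 0 <= r ->
  row_sums_le r A -> row_sums_le (r ^+ k) (A ^+ k).
Proof.
move=> r0 Ar; elim: k => [|k IH].
  rewrite !expr0 => i; rewrite (bigD1 i)//= big1 => [|j ji].
    by rewrite mxE eqxx normc1 addr0.
  by rewrite mxE eq_sym (negbTE ji) normc0.
by rewrite !exprS; apply: row_sums_leM => //; exact: exprn_ge0.
Qed.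

(* Conjugating a triangular matrix by [diag(delta ^ i)] multiplies its [(i, j)]
   entry by [delta ^ (i - j)]. *)
Lemma trigonalization_small_offdiag n (A : 'M[C]_n) (eps : R) : 0 < eps ->
  exists W V : 'M[C]_n, [/\ W *m V = 1%:M,
    forall i, eigenvalue A ((W *m A *m V) i i) &
    forall i j, i != j -> normc ((W *m A *m V) i j) <= eps].
Proof.
move=> eps0; case: n A => [A|n A].
  by exists 1%:M, 1%:M; rewrite mulmx1; split=> // -[].
have [P uP trigP] := Schur A (ltn0Sn n).
have {}uP : P \in unitmx by exact: unitarymx_unit.
move: trigP; rewrite /similar_to conjumx//; set T := P *m A *m invmx P => trigT.
have [K K0 TK] := row_sums_le_ex T.
(* This choice ensures both [delta * K <= eps] and [delta <= 1]; by the latter, [delta] dominates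
   every power [delta ^+ (i - j)] with [j < i]. *)
pose delta := eps / (1 + eps + K).
have den0 : 0 < 1 + eps + K by lra.
have delta0 : 0 < delta by rewrite divr_gt0.
have delta1 : delta <= 1 by rewrite /delta ler_pdivrMr// mul1r -addrA addrC -addrA lerDl addr_ge0.
have deltaK : delta * K <= eps.
  rewrite /delta mulrAC ler_pdivrMr// ler_wpM2l ?(ltW eps0)//.
  by rewrite lerDr addr_ge0// ltW.
pose D : 'M[C]_n.+1 := diag_mx (\row_i (delta ^+ i)%:C).
pose D' : 'M[C]_n.+1 := diag_mx (\row_i ((delta ^+ i)^-1)%:C).
exists (D *m P), (invmx P *m D').
have E : D *m P *m A *m (invmx P *m D') = D *m T *m D' by rewrite /T !mulmxA.
have TE i j : (D *m T *m D') i j = (delta ^+ i / delta ^+ j)%:C * T i j.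
  by rewrite /D /D' mul_mx_diag mxE mul_diag_mx !mxE rmorphM /= mulrAC.
split.
- rewrite mulmxA -(mulmxA D) mulmxV// mulmx1 /D /D' mulmx_diag.
  apply/matrixP => i j; rewrite !mxE; case: eqP => // _.
  by rewrite -rmorphM/= divff ?mulr1n// expf_neq0// gt_eqF.
- move=> i; rewrite E TE divff ?mul1r ?expf_neq0 ?gt_eqF//.
  have : eigenvalue T (T i i).
    rewrite eigenvalue_root_char char_poly_trig// rootE horner_prod (bigD1 i)//=.
    by rewrite hornerXsubC subrr mul0r.
  move=> /eigenvalueP[v vT v0]; apply/eigenvalueP; exists (v *m P).
    have -> : v *m P *m A = v *m T *m P by rewrite /T !mulmxA mulmxKV.
    by rewrite vT scalemxAl.
  by apply: contra v0 => /eqP vP; rewrite -(mulmxK uP v) vP mul0mx.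
- move=> i j ij; rewrite E TE normcM normc_real.
  have [ltij|ltji|/val_inj eqij] := ltngtP i j; last by rewrite eqij eqxx in ij.
    by move/is_trig_mxP : trigT => ->//; rewrite normc0 mulr0 ltW.
  apply: le_trans deltaK; apply: ler_pM => //; first exact: normc_ge0.
    rewrite -(subnK (ltnW ltji)) exprD mulfK ?expf_neq0 ?gt_eqF//.
    rewrite ger0_norm ?exprn_ge0 ?(ltW delta0)//.
    rewrite -[leRHS]expr1; apply: ler_wiXn2l; rewrite ?(ltW delta0)//.
    by rewrite subn_gt0.
  exact: row_sums_le_entry.
Qed.

End complex_row_sums.

Section mxexp_decay.
Variable R : realType.
Local Open Scope complex_scope.
Import ComplexField.Normc.

(** With [X] the square of the left-hand side, [sqrt X <= (1 + X) / 2] because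
    [(sqrt X - 1)^2 >= 0]; the right-hand side is [(1 + X) / 2] expanded. *)
Lemma normc_1B (s : R) (z : R[i]) :
  normc (1 - s%:C * z) <= 1 - s * complex.Re z + s ^+ 2 * (normc z ^+ 2 / 2).
Proof.
case: z => a b; simpc; rewrite /= sqr_sqrtr; last by rewrite addr_ge0 ?sqr_ge0.
set X := _ + _; have X0 : 0 <= X by rewrite addr_ge0 ?sqr_ge0.
have : (Num.sqrt X - 1) ^+ 2 >= 0 by exact: sqr_ge0.
have := sqr_sqrtr X0; set y := Num.sqrt X; move: (y) => {}y; rewrite /X => yX ?.
by nra.
Qed.

Lemma map_mxexpr n (A : 'M[R]_n) k :
  map_mx (real_complex R) (A ^+ k) = map_mx (real_complex R) A ^+ k.
Proof.
elim: k => [|k IH]; first by rewrite !expr0 map_mx1.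
by rewrite !exprS -IH -!mulmxE map_mxM.
Qed.

(** The derivative of the exponential at 0 leaves a remainder [o(s)] in each entry, hence in all of
    them at once since they are finitely many. *)
Lemma mxexp_linearization n (M : 'M[R]_n) (eta : R) : 0 < eta ->
  \forall s \near 0^'+, forall i j,
    `|(mxexp (- s *: M) - 1%:M + s *: M) i j| <= s * eta.
Proof.
move=> eta0; apply: filter_forall => i; apply: filter_forall => j.
have [dM eM] := is_derive_mxexp (- M) i j 0.
have : (fun h : R => h^-1 *: (mxexp ((h *: 1 + 0) *: - M) i j - mxexp (0 *: - M) i j))
    @ 0^'+ --> (- M *m mxexp (0 *: - M)) i j.
  by rewrite -eM; apply: cvg_dnbhs_at_right; exact: dM.
rewrite scale0r mxexp0 mulmx1 => /cvgrPdist_le/(_ _ eta0) cM.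
near=> s.
have s0 : 0 < s by near: s; exact: nbhs_right_gt.
have : `|(- M) i j - s^-1 *: (mxexp ((s *: 1 + 0) *: - M) i j - (1%:M : 'M[R]_n) i j)| <= eta.
  by near: s.
have -> : (s *: 1 + 0) *: - M = - s *: M by rewrite addr0 scaler1 scalerN scaleNr.
rewrite -(ler_pM2l s0) -{1}(gtr0_norm s0) -normrM -normrN.
congr (`|_| <= _); rewrite !mxE; set X := mxexp _ i j; rewrite /GRing.scale /=.
by field; rewrite gt_eqF.
Unshelve. all: by end_near. Qed.

(* [normc (1 - s z) <= 1 - s Re z + O(s^2)], so for small [s] a matrix conjugate
   to [exp(- s M)] has row sums at most [1 - s h <= exp(- s h)]. *)
Lemma mxexp_decay n (M : 'M[R]_n) (h h1 : R) : h < h1 ->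
  (forall z, complex_spectrum M z -> h1 <= complex.Re z) ->
  exists s C : R, [/\ 0 < s, 0 <= C &
    forall k i j, `|(mxexp (- s *: M) ^+ k) i j| <= C * expR (- (s * h)) ^+ k].
Proof.
move=> hh1 spec.
(* The gap is split in three: the quadratic term of [normc_1B], the off-diagonal entries and the
   linearization remainder each cost at most [s * gam]. *)
pose gam := (h1 - h) / 3; have gam0 : 0 < gam by rewrite divr_gt0// subr_gt0.
pose Mc := map_mx (real_complex R) M.
have epsn0 : 0 < gam / n.+1%:R by rewrite divr_gt0.
have [W [V [WV diag offdiag]]] := trigonalization_small_offdiag Mc epsn0.
have VW : V *m W = 1%:M by exact: mulmx1C.
set T := W *m Mc *m V in diag offdiag.
have [KW KW0 hW] := row_sums_le_ex W.
have [KV KV0 hV] := row_sums_le_ex V.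
pose L := \sum_i normc (T i i) ^+ 2 / 2.
have L0 : 0 <= L by apply: sumr_ge0 => i _; rewrite divr_ge0// sqr_ge0.
(* Row sums of the remainder are at most [n s eta], and conjugation by [W] and [V] multiplies them
   by at most [KW * KV]. *)
pose eta := gam / (1 + KW * (n%:R * KV)).
have eta0 : 0 < eta by rewrite divr_gt0// ltr_pwDl// !mulr_ge0.
near ((0 : R)^'+) => s.
have s0 : 0 < s by near: s; exact: nbhs_right_gt.
have sL : s * L <= gam.
  apply: (@le_trans _ _ (s * (1 + L))); first by rewrite ler_wpM2l ?(ltW s0)// lerDr.
  rewrite -ler_pdivlMr ?ltr_pwDl//.
  by near: s; apply: nbhs_right_le; rewrite divr_gt0// ltr_pwDl.
have slin : forall i j, `|(mxexp (- s *: M) - 1%:M + s *: M) i j| <= s * eta.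
  by near: s; exact: mxexp_linearization.
pose Q := map_mx (real_complex R) (mxexp (- s *: M)).
pose Del := map_mx (real_complex R) (mxexp (- s *: M) - 1%:M + s *: M).
have QE : W *m Q *m V = (1%:M - s%:C *: T) + W *m Del *m V.
  have -> : Q = 1%:M - s%:C *: Mc + Del.
    apply/matrixP => i j; rewrite /Q /Del /Mc !mxE.
    by rewrite !rmorphD !rmorphN !rmorphM /= rmorph_nat; ring.
  rewrite mulmxDr mulmxDl mulmxBr mulmxBl mulmx1 WV; congr (_ - _ + _).
  by rewrite -scalemxAr -scalemxAl.
have hDel : row_sums_le (n%:R * (s * eta)) Del.
  move=> i; apply: (@le_trans _ _ (\sum_(j < n) s * eta)).
    by apply: ler_sum => j _; rewrite /Del mxE normc_real.
  by rewrite sumr_const card_ord -[leLHS]mulr_natl.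
have hQ : row_sums_le (expR (- (s * h))) (W *m Q *m V).
  have h2 : row_sums_le (1 - s * h1 + s * gam + s * gam) (1%:M - s%:C *: T).
    move=> i; rewrite (bigD1 i)//=.
    have -> : (1%:M - s%:C *: T) i i = 1 - s%:C * T i i by rewrite !mxE eqxx.
    apply: lerD.
      apply: le_trans (normc_1B _ _) _; apply: lerD.
        by rewrite lerD2l lerN2 ler_wpM2l ?(ltW s0)//; exact/spec/diag.
      rewrite expr2 -mulrA ler_wpM2l ?(ltW s0)// (le_trans _ sL)// ler_wpM2l ?(ltW s0)//.
      rewrite /L (bigD1 i)//= lerDl.
      by apply: sumr_ge0 => k _; rewrite divr_ge0// sqr_ge0.
    apply: (@le_trans _ _ (\sum_(j | j != i) s * (gam / n.+1%:R))).
      have offE (B : 'M[R[i]]_n) j : j != i -> (1%:M - s%:C *: B) i j = - (s%:C * B i j).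
        by move=> ji; rewrite !mxE eq_sym (negbTE ji) sub0r.
      apply: ler_sum => j ji; rewrite offE// normcN normcM.
      by rewrite normc_real gtr0_norm// ler_wpM2l ?(ltW s0)// offdiag// eq_sym.
    rewrite sumr_const -[_ *+ _]mulr_natl mulrCA ler_wpM2l ?(ltW s0)//.
    rewrite mulrCA ger_pMr// ler_pdivrMr// mul1r ler_nat.
    by rewrite (leq_trans (max_card _))// card_ord.
  have h3 : row_sums_le (s * gam) (W *m Del *m V).
    have := row_sums_leM KV0 (row_sums_leM _ hW hDel) hV.
    have nse : 0 <= n%:R * (s * eta) by rewrite mulr_ge0// mulr_ge0// ltW.
    move=> /(_ nse) h3 i; apply: le_trans (h3 i) _.
    have -> : KW * (n%:R * (s * eta)) * KV = s * (eta * (KW * (n%:R * KV))) by ring.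
    rewrite ler_wpM2l ?(ltW s0)// /eta mulrAC ler_pdivrMr ?ltr_pwDl ?mulr_ge0//.
    by rewrite ler_wpM2l ?(ltW gam0)// lerDr.
  rewrite QE => i; apply: le_trans (row_sums_leD h2 h3 i) _.
  apply: le_trans (expR_ge1Dx _).
  have -> : h1 = h + 3 * gam by rewrite /gam; field.
  lra.
exists s, (KV * KW); split=> [//||k i j]; first exact: mulr_ge0.
have e0 : 0 <= expR (- (s * h)) by exact: expR_ge0.
(* Powers commute with the conjugation, so [KV * KW] enters once, independently of [k]. *)
have Qk : Q ^+ k = V *m (W *m Q *m V) ^+ k *m W.
  elim: k => [|k IH]; first by rewrite !expr0 mulmx1 VW.
  rewrite !exprSr -!mulmxE IH !mulmxA.
  by rewrite -(mulmxA _ V W) VW mulmx1.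
rewrite -normc_real.
have -> : ((mxexp (- s *: M) ^+ k) i j)%:C = (Q ^+ k) i j.
  by rewrite /Q -map_mxexpr mxE.
rewrite Qk mulrAC; apply: row_sums_le_entry; apply: row_sums_leM => //.
by apply: row_sums_leM => //; exact: row_sums_leX.
Unshelve. all: by end_near. Qed.

End mxexp_decay.

(** * Pseudo-norms *)

Section pseudo_norm_theory.
Variable R : realType.

(** An eigenvalue is a [z] for which [M - z] is singular, a property that transposition
    preserves. *)
Lemma complex_spectrum_tr n (M : 'M[R]_n) : complex_spectrum M^T = complex_spectrum M.
Proof.
have eigE (A : 'M[R[i]]_n) z : eigenvalue A z = (A - z%:M \notin unitmx).
  by rewrite /eigenvalue kermx_eq0 row_free_unit.
apply/seteqP; split=> z; rewrite /complex_spectrum /= !eigE -map_trmx -[in _^T - _]tr_scalar_mx;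
by rewrite -linearB /= unitmx_tr.
Qed.

Lemma continuous_mulmx m n p (A : 'M[R]_(m, n)) :
  continuous (fun v : 'M[R]_(n, p) => A *m v).
Proof.
move=> v; apply: (cvg_mxP (nbhs_filter v) _ _).2 => i j; rewrite mxE.
under eq_cvg do rewrite mxE.
by apply: cvg_sumr => k; apply: cvgMr; exact: coord_continuous.
Qed.

Lemma continuous_submxcol p (dim : 'I_p -> nat) n l :
  continuous (fun v : 'M[R]_(\sum_l dim l, n) => submxcol v l).
Proof.
move=> v; apply: (cvg_mxP (nbhs_filter v) _ _).2 => i j; rewrite mxE.
under eq_cvg do rewrite mxE.
exact: coord_continuous.
Qed.

Lemma pseudo_norm0 n (M : 'M[R]_n) rho : pseudo_norm M rho -> rho 0 = 0.
Proof.
move=> [_ _ _ hom]; have := hom 0 2 (ltr0Sn _ _).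
by rewrite mulmx0 => h; lra.
Qed.

Lemma pseudo_norm_ge0 n (M : 'M[R]_n) rho x : pseudo_norm M rho -> 0 <= rho x.
Proof.
move=> pn; have [->|x0] := eqVneq x 0; first by rewrite (pseudo_norm0 pn).
by case: pn => _ _ /(_ x x0) /ltW.
Qed.

Lemma jordan_pseudo_norm m1 m2 (dim : 'I_(m1 + m2) -> nat)
    (E P : 'M[R]_(\sum_l dim l)) (B : forall l, 'M[R]_(dim l))
    (tau : forall l, 'cV[R]_(dim l) -> R) :
  positive_spectrum E -> real_jordan_reduction E P B ->
  (forall l, pseudo_norm (B l)^T (tau l)) ->
  pseudo_norm E^T (fun xi => Num.sqrt (\sum_l tau l (submxcol (P^T *m xi) l) ^+ 2)).
Proof.
move=> posE [_ uP EE _ _] tauP; split.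
- by move=> z; rewrite complex_spectrum_tr; exact: posE.
- move=> v.
  apply: (@continuous_comp _ _ _
    (fun xi => \sum_l tau l (submxcol (P^T *m xi) l) ^+ 2) Num.sqrt); last exact: sqrt_continuous.
  apply: (cvg_sumr (nbhs_filter v)) => l; apply: (@continuous_comp _ _ _
    (fun xi => tau l (submxcol (P^T *m xi) l)) (fun y => y ^+ 2)); last exact: exprn_continuous.
  apply: (@continuous_comp _ _ _ (fun xi => submxcol (P^T *m xi) l) (tau l)).
    apply: (@continuous_comp _ _ _ (fun xi => P^T *m xi) (fun y => submxcol y l)).
      exact: continuous_mulmx.
    exact: continuous_submxcol.
  by case: (tauP l) => _ + _ _; exact.
- move=> x x0; rewrite sqrtr_gt0.
  have [l xl] : exists l, submxcol (P^T *m x) l != 0.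
    apply/existsP; apply: contraNT x0; rewrite negb_exists => /forallP x0.
    suff Px : P^T *m x = 0.
      by rewrite -(mulKmx (_ : P^T \in unitmx) x) ?unitmx_tr// Px mulmx0.
    apply/mxcolP => l; rewrite submxcol0.
    by have := x0 l; rewrite negbK => /eqP.
  rewrite (bigD1 l)//=; apply: ltr_pwDl.
    by rewrite exprn_gt0//; case: (tauP l) => _ _ + _; exact.
  by apply: sumr_ge0 => *; exact: sqr_ge0.
- move=> x a a0.
  have intertw : P^T *m mxpow a E^T = mxexp (ln a *: \mxdiag_l (B l)^T) *m P^T.
    rewrite /mxpow (mxexp_intertwine (B := ln a *: E^T))//.
    rewrite -scalemxAr -scalemxAl; congr (_ *: _).
    by rewrite -tr_mxdiag -!trmx_mul EE mulmxKV.
  have -> : \sum_l tau l (submxcol (P^T *m (mxpow a E^T *m x)) l) ^+ 2 =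
      a ^+ 2 * \sum_l tau l (submxcol (P^T *m x) l) ^+ 2.
    rewrite mulr_sumr; apply: eq_bigr => l _.
    rewrite mulmxA intertw -mulmxA submxcol_mxexp -exprMn; congr (_ ^+ 2).
    by case: (tauP l) => _ _ _ /(_ (submxcol (P^T *m x) l) a a0).
  by rewrite sqrtrM ?sqr_ge0// sqrtr_sqr gtr0_norm.
Qed.

End pseudo_norm_theory.

Lemma mulmx_norm_le (R : realType) m n p (A : 'M[R]_(m, n)) (x : 'M[R]_(n, p)) (a : R) :
  0 <= a -> (forall i j, `|A i j| <= a) -> `|A *m x| <= n%:R * a * `|x|.
Proof.
move=> a0 Aa; apply: mx_norm_le => [|i j]; first by rewrite !mulr_ge0.
rewrite mxE (le_trans (ler_norm_sum _ _ _))//.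
apply: (@le_trans _ _ (\sum_(k < n) a * `|x|)).
  by apply: ler_sum => k _; rewrite normrM ler_pM// mx_entry_le.
by rewrite sumr_const card_ord -[leLHS]mulr_natl mulrA.
Qed.

Lemma det_mxX (R : comNzRingType) n (A : 'M[R]_n) k : \det (A ^+ k) = \det A ^+ k.
Proof.
elim: k => [|k IH]; first by rewrite !expr0 det1.
by rewrite !exprS -mulmxE det_mulmx IH.
Qed.

Lemma unitmxX (R : comUnitRingType) n (A : 'M[R]_n) k : A \in unitmx -> A ^+ k \in unitmx.
Proof. by move=> uA; rewrite unitmxE det_mxX unitrX// -unitmxE. Qed.

Lemma invmxX (R : comUnitRingType) n (A : 'M[R]_n) k : A \in unitmx ->
  A ^+ k *m invmx A ^+ k = 1%:M.
Proof.
move=> uA; elim: k => [|k IH]; first by rewrite !expr0 mulmx1.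
by rewrite exprS exprSr -!mulmxE -mulmxA (mulmxA (A ^+ k)) IH mul1mx mulmxV.
Qed.

(** Closed bounded sets of row vectors are compact, and transposition is an isometry for the sup
    norm. *)
Lemma compact_annulus_cV (R : realType) n (a b : R) :
  compact [set x : 'cV[R]_n | a <= `|x| <= b].
Proof.
have ctr p q : continuous (fun v : 'M[R]_(p, q) => v^T).
  move=> v; apply: (cvg_mxP (nbhs_filter v) _ _).2 => i j; rewrite mxE.
  by under eq_cvg do rewrite mxE; exact: coord_continuous.
have ntr p q (v : 'M[R]_(p, q)) : `|v^T| = `|v|.
  apply/eqP; rewrite eq_le; apply/andP; split; apply: mx_norm_le => // i j.
    by rewrite mxE mx_entry_le.
  by have := mx_entry_le v^T j i; rewrite mxE.
have -> : [set x : 'cV[R]_n | a <= `|x| <= b] =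
    (fun v : 'rV[R]_n => v^T) @` [set x : 'rV[R]_n | a <= `|x| <= b].
  apply/seteqP; split=> [x ax|_ [x ax <-]] /=; last by rewrite ntr.
  by exists x^T; rewrite ?trmxK//= ntr.
apply: continuous_compact; first exact/continuous_subspaceT/ctr.
apply: bounded_closed_compact.
  exists b; split; first exact: num_real.
  by move=> M bM x /andP[_ xb]; exact: le_trans xb (ltW bM).
rewrite (_ : mkset _ = (fun x : 'rV[R]_n => `|x|) @^-1` `[a, b]%classic).
  apply: closed_comp; last exact: interval_closed.
  by move=> x _; exact: norm_continuous.
by apply/seteqP; split=> x /=; rewrite in_itv.
Qed.

Section pseudo_norm_sublevel.
Variables (R : realType) (n : nat) (M : 'M[R]_n) (rho : 'cV[R]_n -> R).
Hypotheses (n0 : (0 < n)%N) (pn : pseudo_norm M rho).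
Local Notation muV := (lebesgue_cV R n).

Lemma pseudo_norm_continuous : continuous rho. Proof. by case: pn. Qed.

Lemma measurable_pseudo_norm : measurable_fun setT rho.
Proof. exact: continuous_measurable_cV pseudo_norm_continuous. Qed.

Lemma pseudo_norm_mxexpX t k x :
  rho (mxexp (t *: M) ^+ k *m x) = expR t ^+ k * rho x.
Proof.
elim: k => [|k IH]; first by rewrite !expr0 mul1mx mul1r.
rewrite !exprS -mulmxE -mulmxA -mulrA -IH; case: pn => _ _ _ hom.
by have := hom (mxexp (t *: M) ^+ k *m x) _ (expR_gt0 t); rewrite /mxpow expRK.
Qed.

(* Powers of [Q = exp(- s M)] carry [x] into the unit ball; the last iterate
   outside it lies in a compact annulus, where [rho] is bounded below. *)
Lemma pseudo_norm_sublevel_bounded (s h C : R) : 0 < s -> 0 < h -> 0 <= C ->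
  (forall k i j, `|(mxexp (- s *: M) ^+ k) i j| <= C * expR (- (s * h)) ^+ k) ->
  exists2 c, 0 < c & forall x, rho x < c -> `|x| <= 1.
Proof.
move=> s0 h0 C0 decay; set Q := mxexp (- s *: M) in decay.
have uQ : Q \in unitmx by rewrite unitmxE det_mxexp unitfE gt_eqF// expR_gt0.
(* If [Q *m y] is in the unit ball, then [|y| <= n * |invmx Q|]. The added 1 keeps the annulus
   nonempty, as the minimum of [rho] on it requires. *)
pose K : R := 1 + n%:R * `|invmx Q|.
have [c0 c0A c0min] : exists2 c, c \in [set x : 'cV[R]_n | 1 <= `|x| <= K] &
    forall t, t \in [set x : 'cV[R]_n | 1 <= `|x| <= K] -> rho c <= rho t.
  apply: compact_EVT_min; last 2 first.
  - exact: compact_annulus_cV.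
  - exact/continuous_subspaceT/pseudo_norm_continuous.
  exists (const_mx 1) => /=; rewrite [X in _ <= X <= _](_ : _ = 1).
    by rewrite lexx lerDl mulr_ge0.
  apply/eqP; rewrite eq_le; apply/andP; split.
    by apply: mx_norm_le => // i j; rewrite mxE normr1.
  have := mx_entry_le (const_mx 1 : 'cV[R]_n) (Ordinal n0) ord0.
  by rewrite mxE normr1.
have c0gt0 : 0 < rho c0.
  case: pn => _ _ + _; apply; rewrite -normr_gt0.
  by move: c0A; rewrite inE => /andP[/(lt_le_trans ltr01)].
exists (rho c0) => // x rhox; rewrite leNgt; apply/negP => x1.
have small : exists k, `|Q ^+ k *m x| <= 1.
  have r1 : `|expR (- (s * h))| < 1.
    by rewrite ger0_norm ?expR_ge0// expR_lt1 oppr_lt0 mulr_gt0.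
  have cv : (n%:R * C * `|x|) * expR (- (s * h)) ^+ k @[k --> \oo] --> (n%:R * C * `|x|) * 0.
    by apply: cvgMr; exact: cvg_expr.
  move/cvgrPdist_lt : cv => /(_ 1 ltr01)[k _ /(_ k (leqnn k))].
  rewrite mulr0 sub0r normrN => /ltW hk; exists k.
  apply: le_trans (mulmx_norm_le _ _ (decay k)) _; first by rewrite mulr_ge0// exprn_ge0// expR_ge0.
  apply: le_trans hk; rewrite [leRHS]ger0_norm ?mulr_ge0 ?exprn_ge0 ?expR_ge0//.
  by rewrite le_eqVlt; apply/orP; left; apply/eqP; ring.
case: (ex_minnP small) => k Qk kmin.
case: k Qk kmin => [|k] Qk kmin; first by rewrite expr0 mul1mx leNgt x1 in Qk.
pose y := Q ^+ k *m x.
have y1 : 1 <= `|y|.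
  by rewrite leNgt; apply/negP => /ltW /kmin; rewrite ltnn.
have yK : `|y| <= K.
  have -> : y = invmx Q *m (Q ^+ k.+1 *m x) by rewrite exprS -mulmxE -mulmxA mulKmx.
  apply: le_trans (mulmx_norm_le _ _ (mx_entry_le _)) _ => //.
  apply: (@le_trans _ _ (n%:R * `|invmx Q|)); last by rewrite lerDr.
  by rewrite -[leRHS]mulr1 ler_wpM2l// mulr_ge0.
(* Iterating [Q] cannot increase [rho], so [rho y <= rho x < rho c0], against the minimality of
   [c0]. *)
have := c0min y; rewrite inE /= y1 yK => /(_ isT).
rewrite leNgt pseudo_norm_mxexpX; apply/negP; rewrite negbK.
apply: le_lt_trans rhox; rewrite ler_piMl ?(pseudo_norm_ge0 _ pn)//.
by rewrite exprn_ile1 ?expR_ge0// expR_le1 oppr_le0 ltW.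
Qed.

End pseudo_norm_sublevel.

(** * Integrability of the spectral density *)

Lemma nneseries_geometric_lty (R : realType) (a r : R) : 0 <= a -> 0 <= r < 1 ->
  (\sum_(k <oo) (a * r ^+ k)%:E < +oo)%E.
Proof.
move=> a0 /andP[r0 r1].
apply: (@le_lt_trans _ _ (a / (1 - r))%:E); last exact: ltry.
apply: lime_le.
  by apply: is_cvg_nneseries => k _ _; rewrite lee_fin mulr_ge0// exprn_ge0.
apply: nearW => k; rewrite sumEFin lee_fin.
have := @geometric_seriesE R a r; rewrite lt_eqF// => /(_ isT) /(congr1 (@^~ k)).
rewrite /series /geometric /= => ->.
rewrite ler_pM2r ?invr_gt0 ?subr_gt0// ler_piMr// lerBlDr lerDl exprn_ge0//.
Qed.

(** In logarithmic scale the shell is [[v - s, v[], a fundamental domain for translations by [s]. A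
    floor [m >= 0] of [(u - v) / s] calls for [m + 1] contractions, a floor [- (m + 1)] for [m]
    dilations. *)
Lemma exp_shell (R : realType) (s c r : R) : 0 < s -> 0 < c -> 0 < r -> exists k,
  c * expR (- s) <= expR (- s) ^+ k * r < c \/ c * expR (- s) <= expR s ^+ k * r < c.
Proof.
move=> s0 c0 r0.
rewrite -(lnK (_ : c \in Num.pos)) ?posrE// -(lnK (_ : r \in Num.pos)) ?posrE//.
move: (ln c) (ln r) => v u.
have /andP[j1 j2] := Num.Theory.floor_itv ((u - v) / s).
case: (Num.floor ((u - v) / s)) j1 j2 => m j1 j2.
  exists m.+1; left; rewrite -expRM_natr -!expRD ler_expR ltr_expR.
  move: j1 j2; rewrite ler_pdivlMr// ltr_pdivrMr// intrD -natr1 => j1 j2.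
  by apply/andP; split; nra.
exists m; right; rewrite -expRM_natr -!expRD ler_expR ltr_expR.
move: j1 j2; rewrite ler_pdivlMr// ltr_pdivrMr// NegzE intrD mulrNz -[m.+1%:~R]/(m.+1%:R : R) -natr1 => j1 j2.
by apply/andP; split; nra.
Qed.

Lemma dotv_ge0 (R : realType) n (x : 'cV[R]_n) : 0 <= dotv x x.
Proof. by apply: sumr_ge0 => i _; rewrite -expr2 sqr_ge0. Qed.

Lemma dotv_le_norm (R : realType) n (x : 'cV[R]_n) : dotv x x <= n%:R * `|x| ^+ 2.
Proof.
apply: (@le_trans _ _ (\sum_(i < n) `|x| ^+ 2)).
  apply: ler_sum => i _; rewrite -expr2 -real_normK ?num_real//.
  by rewrite lerXn2r ?nnegrE// mx_entry_le.
by rewrite sumr_const card_ord -[leLHS]mulr_natl.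
Qed.

Lemma lebesgue_cV_ball_fin (R : realType) n (S : set 'cV[R]_n) : measurable S ->
  (forall x, S x -> `|x| <= 1) -> lebesgue_cV R n S \is a fin_num.
Proof.
move=> mS S1; rewrite ge0_fin_numE//.
have mB : measurable (@cV_box R n (fun=> `[-1, 1]%classic)) by exact: measurable_cV_box.
apply: (@le_lt_trans _ _ (lebesgue_cV R n (@cV_box R n (fun=> `[-1, 1]%classic)))).
  apply: le_measure; rewrite ?inE// => x /S1 x1 i /=.
  by rewrite in_itv/= -ler_norml (le_trans (mx_entry_le x i ord0)).
rewrite [ltLHS](lebesgue_cV_box (A := fun=> `[-1, 1]%classic))//.
rewrite -ge0_fin_numE; last by apply: prode_ge0 => i _.
elim/big_ind : _ => //[x y|i _]; first exact: fin_numM.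
by rewrite lebesgue_measure_itv/=; case: ifP.
Qed.

Lemma lebesgue_cV_set0 (R : realType) n : (0 < n)%N -> lebesgue_cV R n [set 0] = 0%E.
Proof.
move=> n0; rewrite (_ : [set 0] = @cV_box R n (fun=> [set 0])).
  rewrite [LHS](lebesgue_cV_box (A := fun=> [set 0]))//.
  by rewrite (bigD1 (Ordinal n0))//= lebesgue_measure_set1 mul0e.
apply/seteqP; split=> [x -> i /=|x x0 /=]; first by rewrite mxE.
by apply/colP => i; rewrite mxE; exact: x0.
Qed.

Section spectral_density.
Variables (R : realType) (n : nat) (M : 'M[R]_n) (rho : 'cV[R]_n -> R) (H h1 : R).
Hypotheses (n0 : (0 < n)%N) (pn : pseudo_norm M rho) (H0 : 0 < H) (Hh1 : H < h1).
Hypothesis spec : forall z, complex_spectrum M z -> h1 <= complex.Re z.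
Local Notation muV := (lebesgue_cV R n).
Local Notation e := (- (2 * H + \tr M)).
Local Notation f := (fun xi => rho xi `^ e).

Lemma measurable_pseudo_norm_powR : measurable_fun setT f.
Proof.
apply: (measurableT_comp (measurable_powR e)).
exact: measurable_pseudo_norm pn.
Qed.

Lemma pseudo_norm_powR_expR t k x y : rho x = expR t ^+ k * rho y ->
  f x = expR (t * e) ^+ k * f y.
Proof.
move=> rxy; rewrite [LHS]/= rxy powRM ?exprn_ge0 ?expR_ge0 ?(pseudo_norm_ge0 _ pn)//; congr (_ * _).
by rewrite -!expRM_natr -expRM; congr expR; ring.
Qed.

Lemma spectral_density_pseudo_norm : spectral_density f.
Proof.
split; first exact: measurable_pseudo_norm_powR.
  exists [set 0]; split; [|exact: lebesgue_cV_set0|].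
    rewrite (_ : [set 0] = @cV_box R n (fun=> [set 0])); first exact: measurable_cV_box.
    apply/seteqP; split=> [x -> i /=|x x0 /=]; first by rewrite mxE.
    by apply/colP => i; rewrite mxE; exact: x0.
  move=> x; apply: contra_notP => x0.
  by apply: powR_gt0; case: pn => _ _ + _; apply; exact/eqP.
(* [h < h1] gives the decay of the powers of [Q], and [H < h] the convergence of the series near the
   origin. *)
pose h := (H + h1) / 2.
have Hh : H < h by exact: (midf_lt Hh1).1.
have hh1 : h < h1 by exact: (midf_lt Hh1).2.
have h0 : 0 < h by rewrite (lt_trans H0).
have [s [C [s0 C0 decay]]] := mxexp_decay hh1 spec.
have [c c0 rhoc] := pseudo_norm_sublevel_bounded n0 pn s0 h0 C0 decay.
set Q := mxexp (- s *: M) in decay.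
have detQ : \det Q = expR (- (s * \tr M)) by rewrite det_mxexp mxtraceZ mulNr.
have uQ : Q \in unitmx by rewrite unitmxE detQ unitfE gt_eqF// expR_gt0.
have uQ' : invmx Q \in unitmx by rewrite unitmx_inv.
(* The ratio of the two bounds is the factor [expR (- s)] by which [Q] multiplies [rho], so
   consecutive images are adjacent; below level [c] the shell lies in the unit ball and has finite
   volume. *)
pose S0 := [set x | c * expR (- s) <= rho x < c].
have mS0 : measurable S0.
  rewrite (_ : S0 = rho @^-1` `[c * expR (- s), c[%classic).
    by rewrite -[X in measurable X]setTI; apply: measurable_pseudo_norm pn _ _ _ => //.
  by apply/seteqP; split=> x /=; rewrite in_itv.
have S0fin : muV S0 \is a fin_num.
  by apply: lebesgue_cV_ball_fin => // x /andP[_ /rhoc].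
pose m0 := fine (muV S0); have m0E : muV S0 = m0%:E by rewrite fineK.
have m00 : 0 <= m0 by rewrite fine_ge0.
(* On the shell [|ln (rho y)| <= |ln c| + s], whatever the sign of the exponent of [f]. *)
pose Kf := expR (`|e| * (`|ln c| + s)).
have Kf0 : 0 <= Kf by exact: expR_ge0.
have fS0 y : S0 y -> f y <= Kf.
  move=> /andP[ry1 ry2]; have ry0 : 0 < rho y by rewrite (lt_le_trans _ ry1)// mulr_gt0// expR_gt0.
  rewrite /powR gt_eqF// ler_expR (le_trans (ler_norm _))// normrM ler_wpM2l//.
  have l1 : ln (rho y) <= ln c by rewrite ler_ln ?posrE// ltW.
  have l2 : ln c - s <= ln (rho y).
    rewrite -[X in _ - X](expRK s) -lnV ?posrE ?expR_gt0// -lnM ?posrE ?invr_gt0 ?expR_gt0//.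
    by rewrite -expRN ler_ln// ?posrE// mulr_gt0// expR_gt0.
  have := ler_norm (ln c); have := ler_norm (- ln c); rewrite normrN ler_norml => ? ?.
  by apply/andP; split; lra.
(* [F k], the image of the shell under [Q ^ (- k)], recedes from the origin, and there the weight is
   bounded by 1. [G k], its image under [Q ^ k], shrinks to the origin, and there the weight is
   bounded by [|xi|^2]. Counting the shell twice for [k = 0] only enlarges the majorant. *)
pose F k := [set x | S0 (Q ^+ k *m x)].
pose G k := [set x | S0 (invmx Q ^+ k *m x)].
have mpre (A : 'M[R]_n) : measurable [set x | S0 (A *m x)].
  by rewrite -[X in measurable X]setTI; apply: measurable_mulmx.
have muF k : muV (F k) = (expR (s * \tr M) ^+ k * m0)%:E.
  have := lebesgue_cV_preimage (unitmxX k uQ) mS0.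
  rewrite det_mxX detQ ger0_norm ?exprn_ge0 ?expR_ge0// m0E => E.
  rewrite EFinM -E muleA -EFinM -exprMn -expRD subrr expR0 expr1n mul1e//.
have muG k : muV (G k) = (expR (- (s * \tr M)) ^+ k * m0)%:E.
  have := lebesgue_cV_preimage (unitmxX k uQ') mS0.
  rewrite det_mxX det_inv detQ -expRN opprK ger0_norm ?exprn_ge0 ?expR_ge0// m0E => E.
  by rewrite EFinM -E muleA -EFinM -exprMn -expRD addrC subrr expR0 expr1n mul1e.
pose r := expR (- (s * h)).
have r0 : 0 <= r by exact: expR_ge0.
(* On [G k] the decay gives [|x| <= n C r^k], and [dotv x x <= n |x|^2]. *)
pose D := n%:R * (n%:R * C) ^+ 2.
have D0 : 0 <= D by rewrite mulr_ge0// sqr_ge0.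
pose a k := Kf * expR (s * e) ^+ k.
pose b k := D * Kf * (r ^+ 2 * expR (- s * e)) ^+ k.
have a0 k : 0 <= a k by rewrite mulr_ge0// exprn_ge0// expR_ge0.
have b0 k : 0 <= b k by rewrite !mulr_ge0// exprn_ge0// mulr_ge0 ?expR_ge0// exprn_ge0.
pose g x := Num.min 1 (dotv x x) * f x.
have gf x : g x <= f x.
  by rewrite ler_piMl ?powR_ge0// ge_min lexx.
have gF k x : F k x -> g x <= a k.
  move=> Fx; apply: le_trans (gf x) _.
  rewrite (@pseudo_norm_powR_expR s k x (Q ^+ k *m x)).
    by rewrite mulrC ler_wpM2r ?exprn_ge0 ?expR_ge0//; exact: fS0.
  by rewrite (pseudo_norm_mxexpX pn) mulrA -exprMn -expRD subrr expR0 expr1n mul1r.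
have gG k x : G k x -> g x <= b k.
  move=> Gx; set y := invmx Q ^+ k *m x in Gx.
  have xy : x = Q ^+ k *m y by rewrite mulmxA invmxX// mul1mx.
  have y1 : `|y| <= 1 by apply: rhoc; case/andP: Gx.
  have xn : `|x| <= n%:R * C * r ^+ k.
    rewrite xy; apply: le_trans (mulmx_norm_le _ _ (decay k)) _.
      by rewrite mulr_ge0// exprn_ge0.
    by rewrite mulrA ler_piMr// !mulr_ge0// exprn_ge0.
  have dx : dotv x x <= D * (r ^+ 2) ^+ k.
    apply: le_trans (dotv_le_norm x) _.
    rewrite /D -mulrA ler_wpM2l// -exprM mulnC exprM -exprMn.
    by rewrite lerXn2r ?nnegrE// !mulr_ge0// exprn_ge0.
  have fx : f x <= expR (- s * e) ^+ k * Kf.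
    rewrite (@pseudo_norm_powR_expR (- s) k x y).
      by rewrite ler_wpM2l ?exprn_ge0 ?expR_ge0//; exact: fS0.
    by rewrite {1}xy (pseudo_norm_mxexpX pn).
  have -> : b k = (D * (r ^+ 2) ^+ k) * (expR (- s * e) ^+ k * Kf).
    by rewrite /b exprMn; ring.
  apply: ler_pM; rewrite ?powR_ge0//; first by rewrite le_min ler01 dotv_ge0.
  by rewrite ge_min dx orbT.
pose w k x := (a k * \1_(F k) x + b k * \1_(G k) x)%:E.
have w0 k x : (0 <= w k x)%E.
  by rewrite lee_fin addr_ge0// mulr_ge0.
have mw k : measurable_fun [set: 'cV[R]_n] (w k).
  apply/measurable_EFinP; apply: measurable_funD; apply: measurable_funM => //;
  by apply: measurable_indic; exact: mpre.
have mg : measurable_fun [set: 'cV[R]_n] (fun x => (g x)%:E).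
  apply/measurable_EFinP; apply: measurable_funM; last exact: measurable_pseudo_norm_powR.
  apply: measurable_minr => //; apply: measurable_sum => i.
  by apply: measurable_funM; exact: measurable_mx_entry.
apply: (@le_lt_trans _ _ (\int[muV]_x \sum_(k <oo) w k x)%E).
  apply: ge0_le_integral => //.
  - by move=> x _; rewrite lee_fin mulr_ge0 ?powR_ge0// le_min ler01 dotv_ge0.
  - exact: ge0_emeasurable_sum.
  (* No shell contains the origin, but the weight vanishes there. *)
  - move=> x _; have [->|x0] := eqVneq x 0.
      rewrite (_ : dotv 0 0 = 0); last by rewrite /dotv big1// => i _; rewrite mxE mul0r.
      rewrite min_r// mul0r; exact: nneseries_ge0.
    have rx0 : 0 < rho x by case: pn => _ _ + _; apply.
    have [k FGk] := exp_shell s0 c0 rx0.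
    apply: (@le_trans _ _ (w k x)); last first.
      apply: le_trans (nneseries_lim_ge k.+1 _); last by move=> j _ _; exact: w0.
      by rewrite big_nat_recr//= leeDr// sume_ge0.
    have [Fx|Gx] := FGk.
      have Fkx : F k x by rewrite /F /S0 /= (pseudo_norm_mxexpX pn).
      rewrite lee_fin; apply: le_trans (gF k x Fkx) _.
      by rewrite indicE mem_set// mulr1 lerDl mulr_ge0.
    have Gkx : G k x.
      rewrite /G /S0 /=; suff -> : rho (invmx Q ^+ k *m x) = expR s ^+ k * rho x by [].
      have {2}-> : x = Q ^+ k *m (invmx Q ^+ k *m x) by rewrite mulmxA invmxX// mul1mx.
      by rewrite (pseudo_norm_mxexpX pn) mulrA -exprMn -expRD subrr expR0 expr1n mul1r.
    rewrite lee_fin; apply: le_trans (gG k x Gkx) _.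
    by rewrite [in leRHS]addrC indicE mem_set// mulr1 lerDl mulr_ge0.
rewrite integral_nneseries//.
(* Each step changes the volume by [expR (s * \tr M)] or its inverse, which the term [\tr M] of the
   exponent of [f] cancels; both remaining ratios are below 1. *)
have iw k : (\int[muV]_x w k x =
    (Kf * m0 * expR (- (2 * H * s)) ^+ k)%:E + (D * Kf * m0 * expR (- (2 * s * (h - H))) ^+ k)%:E)%E.
  rewrite /w; under eq_integral do rewrite EFinD.
  rewrite ge0_integralD//; last 4 first.
  - by move=> x _; rewrite lee_fin mulr_ge0.
  - by apply/measurable_EFinP; apply: measurable_funM => //; apply: measurable_indic; exact: mpre.
  - by move=> x _; rewrite lee_fin mulr_ge0.
  - by apply/measurable_EFinP; apply: measurable_funM => //; apply: measurable_indic; exact: mpre.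
  have iind (t : R) (S : set 'cV[R]_n) : 0 <= t -> measurable S ->
      (\int[muV]_x (t * \1_S x)%:E = t%:E * muV S)%E.
    move=> t0 mS; under eq_integral do rewrite EFinM.
    rewrite ge0_integralZl//; last by apply/measurable_EFinP; exact: measurable_indic.
    by rewrite integral_indic// setIT.
  rewrite !iind//; [|exact: mpre|exact: mpre]; rewrite muF muG -!EFinM.
  congr (_%:E + _%:E)%E.
    have -> : expR (- (2 * H * s)) = expR (s * e) * expR (s * \tr M).
      by rewrite -expRD; congr expR; ring.
    by rewrite /a exprMn; ring.
  have -> : expR (- (2 * s * (h - H))) = r ^+ 2 * expR (- s * e) * expR (- (s * \tr M)).
    by rewrite /r expr2 -!expRD; congr expR; ring.
  by rewrite /b [in RHS]exprMn; ring.
under eq_eseriesr do rewrite iw.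
rewrite nneseriesD//; last 2 first.
- by move=> k _ _; rewrite lee_fin !mulr_ge0// exprn_ge0// expR_ge0.
- by move=> k _ _; rewrite lee_fin !mulr_ge0// exprn_ge0// expR_ge0.
apply: lte_add_pinfty; apply: nneseries_geometric_lty; rewrite ?mulr_ge0//.
- by rewrite expR_ge0 expR_lt1 oppr_lt0 !mulr_gt0.
- by rewrite expR_ge0 expR_lt1 oppr_lt0 !mulr_gt0// subr_gt0.
Qed.

End spectral_density.

(** * The Cramer-Wold theorem *)

Lemma measurable_dotv (R : realType) n (c : 'cV[R]_n) :
  measurable_fun [set: 'cV[R]_n] (dotv c).
Proof.
apply: measurable_sum => k; apply: measurable_funM => //.
exact: measurable_mx_entry.
Qed.

Lemma dotvDl (R : realType) n (x y z : 'cV[R]_n) : dotv (x + y) z = dotv x z + dotv y z.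
Proof. by rewrite /dotv -big_split; apply: eq_bigr => i _; rewrite mxE mulrDl. Qed.

Lemma dotvNl (R : realType) n (x z : 'cV[R]_n) : dotv (- x) z = - dotv x z.
Proof. by rewrite /dotv -sumrN; apply: eq_bigr => i _; rewrite mxE mulNr. Qed.

Lemma dotv_delta (R : realType) n (a : R) i (z : 'cV[R]_n) :
  dotv (a *: delta_mx i ord0) z = a * z i ord0.
Proof.
rewrite /dotv (bigD1 i)//= big1 => [|j ji]; rewrite !mxE ?eqxx ?mulr1 ?addr0//.
by rewrite (negbTE ji) mulr0 mul0r.
Qed.

Section bounded_measurable.
Variables (R : realType) (d : measure_display) (T : measurableType d).

Definition bounded_measurable (f : T -> R) :=
  measurable_fun setT f /\ exists K, forall x, `|f x| <= K.

Lemma bounded_measurable_integrable (m : {measure set T -> \bar R}) f :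
  (m setT < +oo)%E -> bounded_measurable f -> m.-integrable setT (EFin \o f).
Proof.
move=> mfin [mf [K fK]]; apply: measurable_bounded_integrable => //.
by exists K; split; [exact: num_real|move=> x Kx t _; exact: le_trans (fK t) (ltW Kx)].
Qed.

Lemma bounded_measurableM f g : bounded_measurable f -> bounded_measurable g ->
  bounded_measurable (fun x => f x * g x).
Proof.
move=> [mf [K fK]] [mg [L gL]]; split; first exact: measurable_funM.
by exists (K * L) => x; rewrite normrM ler_pM.
Qed.

Lemma bounded_measurableD f g : bounded_measurable f -> bounded_measurable g ->
  bounded_measurable (fun x => f x + g x).
Proof.
move=> [mf [K fK]] [mg [L gL]]; split; first exact: measurable_funD.
by exists (K + L) => x; rewrite (le_trans (ler_normD _ _))// lerD.
Qed.

Lemma bounded_measurable_cst a : bounded_measurable (fun=> a).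
Proof. by split; [exact: measurable_cst|exists `|a|]. Qed.

Lemma bounded_cvg_Rintegral (m : {measure set T -> \bar R}) (f_ : nat -> T -> R) f K :
  (m setT < +oo)%E -> (forall k, measurable_fun setT (f_ k)) ->
  (forall k x, `|f_ k x| <= K) -> (forall x, f_ ^~ x @ \oo --> f x) ->
  \int[m]_x f_ k x @[k --> \oo] --> \int[m]_x f x.
Proof.
move=> mfin mf_ fK f_f.
have mf : measurable_fun setT f by apply: (measurable_fun_cvg mf_) => x _.
have iK : m.-integrable setT (EFin \o (fun=> K)).
  apply: bounded_measurable_integrable => //; exact: bounded_measurable_cst.
have fK' x : `|f x| <= K.
  have cf : `|f_ k x| @[k --> \oo] --> `|f x| by apply: cvg_norm; exact: f_f.
  rewrite -(cvg_lim _ cf)//; apply: limr_le; first by apply/cvg_ex; eexists; exact: cf.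
  exact: nearW.
have ifin : m.-integrable setT (EFin \o f).
  by apply: bounded_measurable_integrable => //; split=> //; exists K.
have ae1 : {ae m, forall x, setT x -> (EFin \o f_ k) x @[k --> \oo] --> (EFin \o f) x}.
  by apply: aeW => x _; apply: cvg_EFin; [exact: nearW|exact: f_f].
have ae2 : {ae m, forall x k, setT x -> (`|(EFin \o f_ k) x| <= (EFin \o (fun=> K)) x)%E}.
  by apply: aeW => x k _; rewrite /= lee_fin.
have mE k : measurable_fun setT (EFin \o f_ k) by exact/measurable_EFinP.
have [_ _ h] := dominated_convergence measurableT mE ((measurable_EFinP _ _).2 mf) ae1 iK ae2.
by apply: fine_cvg; rewrite fineK//; apply: integrable_fin_num.
Qed.

End bounded_measurable.

(* Any algebra containing [h], closed under bounded limits, thus contains the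
   indicator of [0 < h]. *)
Lemma cvg_expexp (R : realType) (h : R) :
  expR (- (k%:R * expR (- (k%:R ^+ 2 * h)))) @[k --> \oo] --> ((0 < h)%R%:R : R).
Proof.
have [h0|h0] := ltP 0 h.
  rewrite -[X in _ --> X]expR0 -[X in expR X]oppr0.
  apply: continuous_cvg; first exact: continuous_expR.
  apply: cvgN; rewrite -(cvg_shiftn 1%N).
  apply: (@squeeze_cvgr _ _ _ _ (fun=> 0) (fun k => h^-1 * harmonic k)).
  - apply: nearW => k; rewrite mulr_ge0 ?expR_ge0//= addn1 /harmonic/=.
    have k0 : 0 < k.+1%:R :> R by rewrite ltr0n.
    rewrite expRN -invfM ler_pdivrMr ?expR_gt0// mulrC -ler_pdivrMr; last first.
      by rewrite invr_gt0 mulr_gt0.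
    rewrite invrK; apply: le_trans (expR_ge1Dx _).
    by rewrite [leLHS](_ : _ = k.+1%:R ^+ 2 * h) ?lerDr//; ring.
  - exact: cvg_cst.
  - rewrite -[X in _ --> X](mulr0 h^-1); apply: cvgMr; exact: cvg_harmonic.
apply: (@squeeze_cvgr _ _ _ _ (fun=> 0) (fun k => expR (- k%:R))).
- apply: nearW => k; rewrite expR_ge0/= ler_expR lerN2 ler_peMr//.
  rewrite -[leLHS]expR0 ler_expR oppr_ge0; apply: mulr_ge0_le0 => //.
- exact: cvg_cst.
- exact: cvgn_expR.
Qed.

Section cramer_wold.
Variables (R : realType) (n : nat) (mu nu : {measure set 'cV[R]_n -> \bar R}).
Hypotheses (mufin : (mu setT < +oo)%E) (nufin : (nu setT < +oo)%E).
Hypothesis munu : forall (c : 'cV[R]_n) (A : set R), measurable A ->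
  mu (dotv c @^-1` A) = nu (dotv c @^-1` A).
Implicit Types f g : 'cV[R]_n -> R.

Definition same_integral f := \int[mu]_x f x = \int[nu]_x f x.

(** The signed measures [f mu] and [f nu] have the same Fourier transform: the phase [t] provides
    the sines along with the cosines. *)
Definition testable f := bounded_measurable f /\
  forall c t, same_integral (fun x => f x * cos (dotv c x + t)).

(* Unlike [testable], this class is an algebra; it is closed under bounded
   pointwise limits and contains the cosines, hence indicators of half-spaces. *)
Definition multiplier g := bounded_measurable g /\
  forall f, testable f -> testable (fun x => g x * f x).

Lemma bounded_measurable_cos (c : 'cV[R]_n) t :
  bounded_measurable (fun x => cos (dotv c x + t)).
Proof.
split; last by exists 1 => x; exact: cos_max.
apply: (measurableT_comp (continuous_measurable_fun (@continuous_cos R))).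
by apply: measurable_funD => //; exact: measurable_dotv.
Qed.

(** A cosine of [dotv c x + t] depends on [x] only through a one-dimensional projection, where
    [munu] identifies the two pushforwards. *)
Lemma testable1 : testable (fun=> 1).
Proof.
split; first exact: bounded_measurable_cst.
move=> c t; rewrite /same_integral /Rintegral.
have mc := measurable_dotv c.
have ig (m : {measure set 'cV[R]_n -> \bar R}) : (m setT < +oo)%E -> m.-integrable setT (EFin \o (fun x => cos (dotv c x + t))).
  by move=> mfin; apply: bounded_measurable_integrable => //; exact: bounded_measurable_cos.
have mcos : measurable_fun [set: R] (fun y => (cos (y + t))%:E).
  apply/measurable_EFinP; apply: (measurableT_comp (continuous_measurable_fun (@continuous_cos R))).
  exact: measurable_funD.
have E (m : {measure set 'cV[R]_n -> \bar R}) : (m setT < +oo)%E ->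
   (\int[m]_x (1 * cos (dotv c x + t))%:E =
   \int[pushforward m (dotv c)]_y (cos (y + t))%:E)%E.
  move=> mfin; have ipre : m.-integrable (dotv c @^-1` setT)
      ((fun y => (cos (y + t))%:E) \o dotv c) by rewrite preimage_setT; exact: ig.
  rewrite (integral_pushforward mc mcos ipre measurableT).
  by rewrite preimage_setT; apply: eq_integral => x _; rewrite mul1r.
rewrite !E//; congr fine; apply: eq_measure_integral => A mA _.
exact: munu.
Qed.

Lemma same_integralD f g : bounded_measurable f -> bounded_measurable g ->
  same_integral f -> same_integral g -> same_integral (fun x => f x + g x).
Proof.
move=> bf bg ef eg; rewrite /same_integral.
by rewrite !RintegralD ?ef ?eg//; exact: bounded_measurable_integrable.
Qed.

Lemma same_integralZ a f : bounded_measurable f ->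
  same_integral f -> same_integral (fun x => a * f x).
Proof.
move=> bf ef; rewrite /same_integral.
by rewrite !RintegralZl ?ef//; exact: bounded_measurable_integrable.
Qed.

Lemma multiplier_testable g : multiplier g -> testable g.
Proof.
move=> [_ /(_ _ testable1)]; rewrite (_ : (fun x => g x * 1) = g)//.
by apply/funext => x; rewrite mulr1.
Qed.

Lemma multiplier_cst a : multiplier (fun=> a).
Proof.
split; first exact: bounded_measurable_cst.
move=> f [bf ef]; split.
  by apply: bounded_measurableM => //; exact: bounded_measurable_cst.
move=> c t; have := same_integralZ a (bounded_measurableM bf (bounded_measurable_cos c t)) (ef c t).
by rewrite /same_integral; under eq_Rintegral do rewrite mulrA;
  under [RHS]eq_Rintegral do rewrite mulrA.
Qed.

Lemma multiplierM f g : multiplier f -> multiplier g -> multiplier (fun x => f x * g x).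
Proof.
move=> [bf mf] [bg mg]; split; first exact: bounded_measurableM.
move=> h th; rewrite (_ : (fun x => _) = (fun x => f x * (g x * h x))).
  exact/mf/mg.
by apply/funext => x; rewrite mulrA.
Qed.

Lemma multiplierD f g : multiplier f -> multiplier g -> multiplier (fun x => f x + g x).
Proof.
move=> [bf mf] [bg mg]; split; first exact: bounded_measurableD.
move=> h th; have [bfh fh] := mf _ th; have [bgh gh] := mg _ th.
split; first by apply: bounded_measurableM; [exact: bounded_measurableD|case: th].
move=> c t; have bc := bounded_measurable_cos c t.
have := same_integralD (bounded_measurableM bfh bc) (bounded_measurableM bgh bc) (fh c t) (gh c t).
rewrite (_ : (fun x => _ + _) = (fun x => (f x + g x) * h x * cos (dotv c x + t)))//.
by apply/funext => x; rewrite !mulrDl.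
Qed.

Lemma multiplier_sum (I : Type) (r : seq I) (F : I -> 'cV[R]_n -> R) :
  (forall i, multiplier (F i)) -> multiplier (fun x => \sum_(i <- r) F i x).
Proof.
move=> mF; elim: r => [|i r IH].
  by under eq_fun do rewrite big_nil; exact: multiplier_cst.
by under eq_fun do rewrite big_cons; exact: multiplierD.
Qed.

Lemma multiplierX f k : multiplier f -> multiplier (fun x => f x ^+ k).
Proof.
move=> mf; elim: k => [|k IH]; first exact: multiplier_cst.
by under eq_fun do rewrite exprS; exact: multiplierM.
Qed.

(** The product of two cosines is half the sum of the cosines with frequencies [c + c'] and
    [c - c']. *)
Lemma multiplier_cos c t : multiplier (fun x => cos (dotv c x + t)).
Proof.
split; first exact: bounded_measurable_cos.
move=> f [bf ef]; have bc := bounded_measurable_cos c t.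
split; first exact: bounded_measurableM.
move=> c' t'.
have h1 := ef (c + c') (t + t'); have h2 := ef (c - c') (t - t').
have b1 := bounded_measurableM bf (bounded_measurable_cos (c + c') (t + t')).
have b2 := bounded_measurableM bf (bounded_measurable_cos (c - c') (t - t')).
have := same_integralZ 2^-1 (bounded_measurableD b1 b2) (same_integralD b1 b2 h1 h2).
rewrite (_ : (fun x => _) = (fun x => cos (dotv c x + t) * f x * cos (dotv c' x + t')))//.
apply/funext => x; rewrite !dotvDl dotvNl.
rewrite (_ : dotv c x + dotv c' x + (t + t') = (dotv c x + t) + (dotv c' x + t')); last by ring.
rewrite (_ : dotv c x - dotv c' x + (t - t') = (dotv c x + t) - (dotv c' x + t')); last by ring.
by rewrite cosD cosB; field.
Qed.

Lemma multiplier_cvg (f_ : nat -> 'cV[R]_n -> R) f K :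
  (forall k, multiplier (f_ k)) -> (forall k x, `|f_ k x| <= K) ->
  (forall x, f_ ^~ x @ \oo --> f x) -> multiplier f.
Proof.
move=> mf_ fK f_f.
have bf : bounded_measurable f.
  split; first by apply: (measurable_fun_cvg (fun k => (mf_ k).1.1)) => x _.
  exists K => x; have cf : `|f_ k x| @[k --> \oo] --> `|f x| by apply: cvg_norm; exact: f_f.
  rewrite -(cvg_lim _ cf)//; apply: limr_le; first by apply/cvg_ex; eexists; exact: cf.
  exact: nearW.
split=> // g tg; have bg := tg.1; split; first exact: bounded_measurableM.
move=> c t; have bc := bounded_measurable_cos c t.
have [mg [L gL]] := bg.
have cvg_int (m : {measure set 'cV[R]_n -> \bar R}) : (m setT < +oo)%E ->
    \int[m]_x (f_ k x * g x * cos (dotv c x + t)) @[k --> \oo] -->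
    \int[m]_x (f x * g x * cos (dotv c x + t)).
  move=> mfin; apply: (@bounded_cvg_Rintegral _ _ _ m _ _ (K * L * 1)) => //.
  - move=> k; apply: measurable_funM; last exact: bc.1.
    by apply: measurable_funM => //; exact: (mf_ k).1.1.
  - by move=> k x; rewrite !normrM ler_pM ?mulr_ge0// ?cos_max// ler_pM.
  - move=> x; apply: cvgMl; apply: cvgMl; exact: f_f.
have h1 := cvg_int mu mufin; have h2 := cvg_int nu nufin.
apply: cvg_unique h1 _ => //.
rewrite (_ : (fun k => _) = (fun k => \int[nu]_x (f_ k x * g x * cos (dotv c x + t))))//.
by apply/funext => k; exact: ((mf_ k).2 g tg).2.
Qed.

(** The partial sums of the exponential series are polynomials in [f], uniformly bounded by [expR K]
    when [|f| <= K]. *)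
Lemma multiplier_expR f : multiplier f -> multiplier (fun x => expR (f x)).
Proof.
move=> mf; have [_ [K fK]] := mf.1.
apply: (@multiplier_cvg (fun k x => series (exp_coeff (f x)) k) _ (expR K)).
- move=> k; apply: multiplier_sum => i.
  have := multiplierM (multiplierX i mf) (multiplier_cst (i`!%:R)^-1).
  by [].
- move=> k x; rewrite /series/= (le_trans (ler_norm_sum _ _ _))//.
  have K0 : 0 <= K by exact: le_trans (fK x).
  apply: (@le_trans _ _ (series (exp_coeff K) k)).
    apply: ler_sum => i _; rewrite /exp_coeff/= normrM normrX normrV ?unitfE ?pnatr_eq0 -?lt0n ?fact_gt0//.
    by rewrite normr_nat ler_wpM2r// lerXn2r// nnegrE.
  apply: nondecreasing_cvgn_le; last exact: is_cvg_series_exp_coeff.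
  by apply: nondecreasing_series => i _ _; exact: exp_coeff_ge0.
- by move=> x; exact: is_cvg_series_exp_coeff.
Qed.

Lemma multiplier_gt0 f : multiplier f -> multiplier (fun x => (0 < f x)%R%:R).
Proof.
move=> mf.
apply: (@multiplier_cvg (fun k x => expR (- (k%:R * expR (- (k%:R ^+ 2 * f x))))) _ 1).
- move=> k; apply: multiplier_expR.
  have := multiplierM (multiplier_cst (- k%:R))
    (multiplier_expR (multiplierM (multiplier_cst (- k%:R ^+ 2)) mf)).
  rewrite (_ : (fun x => _ * expR _) = (fun x => - (k%:R * expR (- (k%:R ^+ 2 * f x)))))//.
  by apply/funext => x; rewrite !mulNr.
- by move=> k x; rewrite ger0_norm ?expR_ge0// expR_le1 oppr_le0 mulr_ge0// expR_ge0.
- by move=> x; exact: cvg_expexp.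
Qed.

(** A coordinate is unbounded, hence not a multiplier. It is replaced by [sin ((x i - a) / k.+1)], a
    shifted cosine, whose sign is eventually that of [x i - a] for each fixed [x]. *)
Lemma multiplier_coord i a : multiplier (fun x : 'cV[R]_n => (a < x i ord0)%R%:R).
Proof.
apply: (@multiplier_cvg (fun k x => (0 < sin (k.+1%:R^-1 * (x i ord0 - a)))%R%:R) _ 1).
- move=> k; apply: multiplier_gt0.
  have := multiplier_cos (k.+1%:R^-1 *: delta_mx i ord0) (- (k.+1%:R^-1 * a) - pi / 2).
  rewrite (_ : (fun x => cos _) = (fun x : 'cV[R]_n => sin (k.+1%:R^-1 * (x i ord0 - a))))//.
  by apply/funext => x; rewrite dotv_delta addrA cosBpihalf mulrBr.
- by move=> k x; case: ltP; rewrite ?normr1 ?normr0.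
- move=> x; set u : R := x i ord0.
  have small (v : R) : 0 < v -> \forall k \near \oo, 0 < sin (k.+1%:R^-1 * v).
    move=> v0; near=> k; apply: sin_gt0_pi; apply/andP; split.
      by rewrite mulr_gt0// invr_gt0.
    rewrite mulrC ltr_pdivrMr// (@lt_trans _ _ (k.+1%:R))//.
      near: k; exists (Num.truncn v) => // j /= ij.
      by rewrite (lt_le_trans (truncnS_gt v))// ler_nat ltnS.
    rewrite ltr_pMl// (lt_le_trans _ (pi_ge2 _))//.
    by rewrite ltr1n.
  apply: cvg_near_cst; case: (ltgtP a u) => [au|ua|->].
  - have := small (u - a); rewrite subr_gt0 => /(_ au); apply: filterS => k ->//.
  - have := small (a - u); rewrite subr_gt0 => /(_ ua); apply: filterS => k h.
    by rewrite -[u - a]opprB mulrN sinN oppr_gt0 ltNge (ltW h).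
  - by apply: nearW => k; rewrite subrr mulr0 sin0 ltxx.
Unshelve. all: by end_near. Qed.

Definition multiplier_set (S : set 'cV[R]_n) := multiplier (\1_S).

(** Finite unions come from the algebra structure; for a countable union, the indicators of the
    partial unions are eventually constant at each point. *)
Lemma multiplier_set_sigma_algebra : sigma_algebra setT multiplier_set.
Proof.
have m0 : multiplier_set set0.
  by rewrite /multiplier_set indic0; exact: multiplier_cst.
have mC S : multiplier_set S -> multiplier_set (~` S).
  move=> mS; have := multiplierD (multiplier_cst 1) (multiplierM (multiplier_cst (-1)) mS).
  rewrite /multiplier_set (_ : (fun x => _) = \1_(~` S))//.
  by apply/funext => x; rewrite !indicE in_setC mulN1r; case: (x \in S) => /=; rewrite ?subrr ?subr0.
have mI S S' : multiplier_set S -> multiplier_set S' -> multiplier_set (S `&` S').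
  move=> mS mS'; have := multiplierM mS mS'.
  by rewrite /multiplier_set indicI.
have mU S S' : multiplier_set S -> multiplier_set S' -> multiplier_set (S `|` S').
  by move=> mS mS'; rewrite -[S `|` S']setCK setCU; apply/mC/mI; exact/mC.
split=> // [S mS|F mF]; first by rewrite setTD; exact: mC.
have mB k : multiplier_set (\big[setU/set0]_(i < k) F i).
  by elim/big_ind : _ => // i _.
apply: (@multiplier_cvg (fun k => \1_(\big[setU/set0]_(i < k) F i)) _ 1).
- exact: mB.
- by move=> k x; rewrite indicE; case: (x \in _); rewrite ?normr1 ?normr0.
- move=> x; apply: cvg_near_cst; rewrite indicE.
  have [[k _ Fkx]|nF] := pselect ((\bigcup_k F k) x).
    exists k.+1 => // j /= kj; rewrite indicE.
    have F1 : (\bigcup_k F k) x by exists k.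
    have F2 : (\big[setU/set0]_(i < j) F i) x by rewrite -bigcup_mkord; exists k.
    by rewrite (mem_set F1) (mem_set F2).
  apply: nearW => k; rewrite indicE !memNset// -bigcup_mkord => -[j jk Fj].
  by apply: nF; exists j.
Qed.

Lemma measurable_multiplier_set (S : set 'cV[R]_n) : measurable S -> multiplier_set S.
Proof.
have [S0 SC SU] := multiplier_set_sigma_algebra.
apply: smallest_sub; first exact: multiplier_set_sigma_algebra.
move=> _ [i [j [B mB ->]]]; rewrite ord1 {j}.
have : (@RGenOInfty.G R).-sigma.-measurable B by rewrite -RGenOInfty.measurableE.
apply: (@smallest_sub _ _ _ [set B | multiplier_set [set M : 'cV[R]_n | B (M i ord0)]]).
  split=> /= [|A mA|F mF].
  - exact: S0.
  - by have := SC _ mA; congr multiplier_set; apply/seteqP; split=> x /=.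
  - by have := SU _ mF; congr multiplier_set; apply/seteqP; split=> x /=.
move=> _ [x ->] /=; have := multiplier_coord i x.
rewrite /multiplier_set; congr multiplier; apply/funext => v.
by rewrite indicE; congr ((nat_of_bool _)%:R); apply/idP/idP; rewrite inE/= in_itv/= andbT.
Qed.

Theorem cramer_wold (S : set 'cV[R]_n) : measurable S -> mu S = nu S.
Proof.
(* At zero frequency and phase the cosine is 1, and the integral of the indicator is the measure. *)
move=> mS; have [_ /(_ 0 0)] := multiplier_testable (measurable_multiplier_set mS).
rewrite /same_integral /Rintegral.
have E (m : {measure set 'cV[R]_n -> \bar R}) :
    (\int[m]_x (\1_S x * cos (dotv 0 x + 0))%:E = m S)%E.
  rewrite -[in RHS](setIT S) -integral_indic//; apply: eq_integral => x _.
  have -> : dotv (0 : 'cV[R]_n) x = 0 by rewrite /dotv big1// => i _; rewrite mxE mul0r.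
  by rewrite addr0 cos0 mulr1.
have F (m : {measure set 'cV[R]_n -> \bar R}) : (m setT < +oo)%E -> m S \is a fin_num.
  move=> mfin; rewrite ge0_fin_numE//; apply: le_lt_trans mfin.
  by apply: le_measure; rewrite ?inE.
by rewrite !E => h; rewrite -(fineK (F _ mufin)) -(fineK (F _ nufin)) h.
Qed.

End cramer_wold.

(** * Centered Gaussian fields *)

Section square_integrable.
Variables (R : realType) (d : measure_display) (T : measurableType d).
Variable m : {measure set T -> \bar R}.
Hypothesis mfin : (m setT < +oo)%E.

Definition square_integrable (f : T -> R) :=
  measurable_fun setT f /\ m.-integrable setT (EFin \o (fun x => f x ^+ 2)).

Lemma square_integrableM f g : square_integrable f -> square_integrable g ->
  m.-integrable setT (EFin \o (fun x => f x * g x)).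
Proof.
move=> [mf fi] [mg gi].
apply: (le_integrable measurableT _ _ (integrableD measurableT fi gi)).
  by apply/measurable_EFinP; exact: measurable_funM.
move=> x _; rewrite /= lee_fin normrM [leRHS]ger0_norm ?addr_ge0 ?sqr_ge0//.
have := sqr_ge0 (`|f x| - `|g x|).
have := sqr_ge0 (f x); have := sqr_ge0 (g x).
rewrite -[f x ^+ 2]real_normK ?num_real// -[g x ^+ 2]real_normK ?num_real//.
have := normr_ge0 (f x); have := normr_ge0 (g x).
move: `|f x| `|g x| => a b; nra.
Qed.

Lemma square_integrable_cst a : square_integrable (fun=> a).
Proof.
split; first exact: measurable_cst.
apply: measurable_bounded_integrable => //.
by exists `|a ^+ 2|; split; [exact: num_real|move=> x ax t _; exact: ltW].
Qed.

Lemma square_integrable_integrable f : square_integrable f ->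
  m.-integrable setT (EFin \o f).
Proof.
move=> fi; have := square_integrableM fi (square_integrable_cst 1).
by congr (m.-integrable _ _); apply/funext => x; rewrite /= mulr1.
Qed.

Lemma square_integrableD f g : square_integrable f -> square_integrable g ->
  square_integrable (fun x => f x + g x).
Proof.
move=> fi gi; have := square_integrableM fi gi => fgi.
case: fi gi => [mf fi] [mg gi]; split; first exact: measurable_funD.
have := integrableD measurableT (integrableD measurableT fi (integrableZl measurableT 2 fgi)) gi.
congr (m.-integrable _ _); apply/funext => x; rewrite /= -EFinM -!EFinD; congr EFin; ring.
Qed.

Lemma square_integrableZ a f : square_integrable f -> square_integrable (fun x => a * f x).
Proof.
move=> [mf fi]; split; first exact: measurable_funM.
have := integrableZl measurableT (a ^+ 2) fi.
by congr (m.-integrable _ _); apply/funext => x; rewrite /= -EFinM exprMn.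
Qed.

Lemma square_integrable_sum (I : Type) (r : seq I) (F : I -> T -> R) :
  (forall i, square_integrable (F i)) ->
  square_integrable (fun x => \sum_(i <- r) F i x).
Proof.
move=> Fi; elim: r => [|i r IH].
  by under eq_fun do rewrite big_nil; exact: square_integrable_cst.
by under eq_fun do rewrite big_cons; exact: square_integrableD.
Qed.

End square_integrable.

Lemma same_law_integral (R : realType) d1 d2 d3 (T1 : measurableType d1)
    (T2 : measurableType d2) (T3 : measurableType d3)
    (m1 : {measure set T1 -> \bar R}) (m2 : {measure set T2 -> \bar R})
    (f1 : T1 -> T3) (f2 : T2 -> T3) (g : T3 -> \bar R) :
  measurable_fun setT f1 -> measurable_fun setT f2 ->
  (forall A, measurable A -> m1 (f1 @^-1` A) = m2 (f2 @^-1` A)) ->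
  measurable_fun setT g -> m1.-integrable setT (g \o f1) ->
  m2.-integrable setT (g \o f2) /\ (\int[m1]_x g (f1 x) = \int[m2]_x g (f2 x))%E.
Proof.
move=> mf1 mf2 m12 mg gi.
pose p1 := measure_function_pushforward__canonical__measure_function_Measure m1 mf1.
pose p2 := measure_function_pushforward__canonical__measure_function_Measure m2 mf2.
have p12 (h : T3 -> \bar R) : (\int[p1]_y h y = \int[p2]_y h y)%E.
  by apply: eq_measure_integral => A mA _; exact: m12.
have gi2 : m2.-integrable setT (g \o f2).
  move/integrableP : gi => [_ gi]; apply/integrableP; split; first exact: measurableT_comp.
  have ma : measurable_fun setT (abse \o g) by exact: measurableT_comp.
  have := p12 (abse \o g); rewrite /p1 /p2 /=.
  rewrite (ge0_integral_pushforward mf1 m1 measurableT ma (fun x _ => abse_ge0 _)).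
  rewrite (ge0_integral_pushforward mf2 m2 measurableT ma (fun x _ => abse_ge0 _)).
  by rewrite !preimage_setT /= => <-.
split=> //; have := p12 g; rewrite /p1 /p2 /=.
have gi1' : m1.-integrable (f1 @^-1` setT) (g \o f1) by rewrite preimage_setT.
have gi2' : m2.-integrable (f2 @^-1` setT) (g \o f2) by rewrite preimage_setT.
rewrite (integral_pushforward mf1 mg gi1' measurableT).
by rewrite (integral_pushforward mf2 mg gi2' measurableT) !preimage_setT.
Qed.

(** * One-dimensional Gaussian laws *)

Section gaussian_law.
Variable R : realType.
Definition std_normal : probability (measurableTypeR R) R := normal_prob 0 1.
Local Notation N01 := std_normal.

(** Negative [s] is included: [s = -1] yields the symmetry of the standard law. *)
Lemma normal_prob_affine (a s : R) (A : set R) : s != 0 -> measurable A ->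
  normal_prob a s A = N01 ((fun z => s * z + a) @^-1` A).
Proof.
move=> s0 mA.
have mg : measurable_fun [set: R] (fun z : R => s * z + a).
  by apply: measurable_funD => //; apply: measurable_funM.
have mB : measurable ((fun z : R => s * z + a) @^-1` A).
  by rewrite -[X in measurable X]setTI; exact: mg.
pose p (x : R) := (normal_pdf a s x)%:E.
have mp : measurable_fun [set: R] p by apply/measurable_EFinP; exact: measurable_normal_pdf.
have mpA : measurable_fun [set: R] (p \_ A).
  by exact: ((measurable_restrictT p mA).1 (measurable_funTS mp)).
have p0 x : (0 <= (p \_ A) x)%E.
  by rewrite patchE; case: ifP => // _; rewrite lee_fin normal_pdf_ge0.
rewrite /normal_prob integral_mkcond [RHS]integral_mkcond.
rewrite -(ge0_lebesgue_affine a s0 mpA p0).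
have mpA' : measurable_fun [set: measurableTypeR R] (fun x => (p \_ A) (s * x + a)).
  exact: measurableT_comp.
rewrite -ge0_integralZl//.
apply: eq_integral => z _; rewrite !patchE.
have -> : (z \in (fun z0 : R => s * z0 + a) @^-1` A) = (s * z + a \in A).
  by apply/idP/idP; rewrite !inE.
case: ifP => _; last by rewrite mule0.
rewrite /p -EFinM; congr EFin.
rewrite !normal_pdfE ?oner_neq0//= /normal_peak /normal_fun.
rewrite -[s ^+ 2 * pi *+ 2]mulrnAr sqrtrM ?sqr_ge0// sqrtr_sqr expr1n mul1r invfM !mulrA.
rewrite divff ?normr_eq0// mul1r subr0 addrK; congr (_ * expR _).
rewrite exprMn -mulr_natr -[1 *+ 2]mulr_natr; field.
by rewrite s0.
Qed.

(** Representing the law as that of [s Z + a] puts the Dirac case [s = 0] and the nondegenerate case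
    in one form. *)
Lemma gaussian_rv_affine d (T : measurableType d) (Pr : probability T R) (Y : T -> R) :
  gaussian_rv Pr Y -> exists a s : R, 0 <= s /\ forall A, measurable A -> Pr (Y @^-1` A) = N01 ((fun z => s * z + a) @^-1` A).
Proof.
move=> [a [s [s0 Ylaw]]]; exists a, s; split=> // A mA; rewrite Ylaw//.
case: eqP => [->|/eqP sn0]; last by rewrite normal_prob_affine.
rewrite diracE; case: (boolP (a \in A)) => aA.
  rewrite (_ : _ @^-1` A = setT) ?probability_setT//.
  by apply/seteqP; split=> // z _ /=; rewrite mul0r add0r; exact/set_mem.
rewrite (_ : _ @^-1` A = set0) ?measure0//.
by apply/seteqP; split=> // z /=; rewrite mul0r add0r => /mem_set; rewrite (negbTE aA).
Qed.

Lemma N01_symmetric (A : set R) : measurable A -> N01 (id @^-1` A) = N01 (-%R @^-1` A).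
Proof.
move=> mA; have s0 : (-1 : R) != 0 by rewrite oppr_eq0 oner_eq0.
have := normal_prob_affine 0 s0 mA.
have -> : normal_prob (0 : R) (-1) A = N01 A.
  rewrite /normal_prob; apply: eq_integral => x _; congr EFin.
  by rewrite !normal_pdfE ?oner_neq0//= /normal_peak /normal_fun sqrrN.
rewrite preimage_id => ->; congr (N01 _); apply/seteqP.
by split=> x /=; rewrite addr0 mulN1r.
Qed.

Lemma N01_fin : (N01 setT < +oo)%E.
Proof. by rewrite probability_setT ltry. Qed.

Lemma N01_mean : N01.-integrable setT (EFin \o (id : measurableTypeR R -> R)) -> \int[N01]_x x = 0.
Proof.
move=> iN.
have mid : measurable_fun [set: measurableTypeR R] (id : measurableTypeR R -> R) by exact: measurable_id.
have mopp : measurable_fun [set: measurableTypeR R] (-%R : R -> R) by exact: oppr_measurable.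
have mE : measurable_fun [set: measurableTypeR R] (@EFin R) by apply/measurable_EFinP; exact: measurable_id.
have [_ h] := @same_law_integral R _ _ _ _ _ _ N01 N01 _ _ _ mid mopp N01_symmetric mE iN.
have e : \int[N01]_x x = \int[N01]_x (- x) by rewrite /Rintegral h.
have : \int[N01]_x (- x) = - \int[N01]_x x.
  rewrite -mulN1r -RintegralZl//.
  by under [RHS]eq_Rintegral do rewrite mulN1r.
by move=> e2; move: e; rewrite e2 => e; lra.
Qed.

(** Nonvanishing allows this factor to be cancelled when two variances are compared. If it were
    zero, the law would be carried by [{0}], which is null by absolute continuity. *)
Lemma N01_second_moment_neq0 :
  N01.-integrable setT (EFin \o (fun x : measurableTypeR R => x ^+ 2)) -> \int[N01]_x x ^+ 2 != 0.
Proof.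
move=> iN; apply/negP => /eqP i0.
have i0' : (\int[N01]_x `|(x ^+ 2)%:E| = 0)%E.
  under eq_integral do rewrite abse_EFin ger0_norm ?sqr_ge0//.
  rewrite -[LHS]fineK ?(integrable_fin_num _ iN)//.
  by rewrite -[fine _]/(\int[N01]_x x ^+ 2) i0.
have mx2 : measurable_fun [set: measurableTypeR R] (EFin \o (fun x : measurableTypeR R => x ^+ 2)).
  by case/integrableP : iN.
have [N [mN N0 subN]] := (ae_eq_integral_abs N01 measurableT mx2).1 i0'.
have : N01 ([set (0 : R)] `|` N) = 0%E.
  apply: null_set_setU => //.
  have := @normal_prob_dominates R 0 1.
  move=> /null_content_dominatesP; apply => //.
  exact: lebesgue_measure_set1.
have -> : [set (0 : R)] `|` N = setT.
  apply/seteqP; split=> // x _; have [->|x0] := eqVneq x 0; first by left.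
  right; apply: subN => /= h; have /eqP := h I.
  by rewrite /= eqe sqrf_eq0 (negbTE x0).
by rewrite probability_setT => /eqP; rewrite eqe oner_eq0.
Qed.

(** The law of [Y] is that of [s Z + a], and a zero mean forces [a = 0] by symmetry of [Z]. Square
    integrability passes from [Y] to [Z] by inverting the affine map, whence the condition [s != 0]
    in the last conclusion. *)
Lemma gaussian_rv_moments d (T : measurableType d) (Pr : probability T R) (Y : T -> R) :
  gaussian_rv Pr Y -> square_integrable Pr Y -> \int[Pr]_w Y w = 0 ->
  exists s : R, [/\ 0 <= s,
    forall A, measurable A -> Pr (Y @^-1` A) = N01 ((fun z => s * z) @^-1` A),
    s ^+ 2 * \int[N01]_z z ^+ 2 = \int[Pr]_w Y w ^+ 2 &
    s != 0 -> N01.-integrable setT (EFin \o (fun x : measurableTypeR R => x ^+ 2))].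
Proof.
move=> /gaussian_rv_affine[a [s [s0 law]]] sqY Y0.
have Pfin : (Pr setT < +oo)%E by rewrite probability_setT ltry.
have mY := sqY.1.
have maff (b : R) : measurable_fun [set: measurableTypeR R] (fun z : measurableTypeR R => s * z + b).
  by apply: measurable_funD => //; apply: measurable_funM.
have mE : measurable_fun [set: measurableTypeR R] (@EFin R) by apply/measurable_EFinP; exact: measurable_id.
have m2 : measurable_fun [set: measurableTypeR R] (fun y : measurableTypeR R => (y ^+ 2)%:E).
  by apply/measurable_EFinP; exact: measurable_funX.
have [iaff eaff] := @same_law_integral R _ _ _ _ _ _ Pr N01 _ _ _ mY (maff a) law mE (square_integrable_integrable Pfin sqY).
have [iaff2 eaff2] := @same_law_integral R _ _ _ _ _ _ Pr N01 _ _ _ mY (maff a) law m2 sqY.2.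
have sqaff : square_integrable N01 (fun z => s * z + a) by split.
have sqid : s != 0 -> square_integrable N01 (id : measurableTypeR R -> R).
  move=> sn0.
  have := square_integrableZ s^-1 (square_integrableD sqaff (square_integrable_cst N01_fin (- a))).
  congr square_integrable; apply/funext => z; rewrite addrK mulrA mulVf// mul1r//.
have a0 : a = 0.
  have e : \int[N01]_z (s * z + a) = 0 by rewrite -Y0 /Rintegral eaff.
  move: e; have [->|sn0] := eqVneq s 0.
    under eq_Rintegral do rewrite mul0r add0r.
    rewrite Rintegral_cst//= probability_setT /= mulr1; exact.
  have iid := square_integrable_integrable N01_fin (sqid sn0).
  rewrite RintegralD//; last 2 first.
  - exact: (integrableZl measurableT s iid).
  - have ca : square_integrable N01 (fun=> a) by exact: square_integrable_cst N01_fin a.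
    by have := square_integrable_integrable N01_fin ca.
  rewrite RintegralZl// N01_mean// mulr0 add0r Rintegral_cst//=.
  by rewrite probability_setT /= mulr1.
exists s; split=> //.
- by move=> A mA; rewrite law//; congr (N01 _); apply/seteqP; split=> z /=; rewrite a0 addr0.
- have <- : \int[N01]_z (s * z + a) ^+ 2 = \int[Pr]_w Y w ^+ 2 by rewrite /Rintegral eaff2.
  rewrite a0; have [->|sn0] := eqVneq s 0.
    under [RHS]eq_Rintegral do rewrite mul0r add0r expr0n /=.
    by rewrite Rintegral_cst// mul0r expr0n mul0r.
  under [RHS]eq_Rintegral do rewrite addr0 exprMn.
  by rewrite RintegralZl//; exact: (sqid sn0).2.
- by move=> /sqid[].
Qed.

(** Equal variances give [s1 ^+ 2 = s2 ^+ 2], and both scales are nonnegative. A zero scale is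
    treated apart, since the standard second moment is controlled only through a nonzero one. *)
Lemma gaussian_rv_same_law d (T : measurableType d) (Pr : probability T R) (Y1 Y2 : T -> R) :
  gaussian_rv Pr Y1 -> gaussian_rv Pr Y2 ->
  square_integrable Pr Y1 -> square_integrable Pr Y2 ->
  \int[Pr]_w Y1 w = 0 -> \int[Pr]_w Y2 w = 0 ->
  \int[Pr]_w Y1 w ^+ 2 = \int[Pr]_w Y2 w ^+ 2 ->
  forall A, measurable A -> Pr (Y1 @^-1` A) = Pr (Y2 @^-1` A).
Proof.
move=> g1 g2 sq1 sq2 m1 m2 e12 A mA.
have [s1 [s10 law1 v1 i1]] := gaussian_rv_moments g1 sq1 m1.
have [s2 [s20 law2 v2 i2]] := gaussian_rv_moments g2 sq2 m2.
rewrite law1// law2//; suff -> : s1 = s2 by [].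
have [s1n0|s1n0] := eqVneq s1 0; have [s2n0|s2n0] := eqVneq s2 0.
- by rewrite s1n0 s2n0.
- exfalso; have := N01_second_moment_neq0 (i2 s2n0).
  move: v2; rewrite -e12 -v1 s1n0 expr0n mul0r => /eqP.
  by rewrite mulf_eq0 sqrf_eq0 (negbTE s2n0) /= => ->.
- exfalso; have := N01_second_moment_neq0 (i1 s1n0).
  move: v1; rewrite e12 -v2 s2n0 expr0n mul0r => /eqP.
  by rewrite mulf_eq0 sqrf_eq0 (negbTE s1n0) /= => ->.
- have k0 := N01_second_moment_neq0 (i1 s1n0).
  move: v1; rewrite e12 -v2 => /(mulIf k0) /eqP.
  by rewrite eqrXn2// => /eqP.
Qed.

End gaussian_law.

(** * The covariance of the field *)

(** Positive and negative parts are substituted separately; their new integrals are finite because a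
    nonzero multiple of them is, so the subtraction is legitimate. *)
Lemma Rintegral_linear_substitution (R : realType) n (A : 'M[R]_n) (g : 'cV[R]_n -> R) :
  A \in unitmx -> (lebesgue_cV R n).-integrable setT (EFin \o g) ->
  `|\det A| * \int[lebesgue_cV R n]_v g (A *m v) = \int[lebesgue_cV R n]_v g v.
Proof.
move=> uA ig; have cA := changes_variables_unitmx uA.
have d0 : `|\det A| != 0 by rewrite normr_eq0 -unitfE -unitmxE.
have mg := measurable_int _ ig.
have mp : measurable_fun [set: 'cV[R]_n] (EFin \o g)^\+%E by exact: measurable_funepos.
have mn : measurable_fun [set: 'cV[R]_n] (EFin \o g)^\-%E by exact: measurable_funeneg.
have Ep := cA _ mp (fun v => funepos_ge0 _ v).
have En := cA _ mn (fun v => funeneg_ge0 _ v).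
set muV := lebesgue_cV R n in Ep En *.
have Pfin : (\int[muV]_v (EFin \o g)^\+%E v)%E \is a fin_num.
  by apply: integrable_fin_num => //; exact: integrable_funepos.
have Nfin : (\int[muV]_v (EFin \o g)^\-%E v)%E \is a fin_num.
  by apply: integrable_fin_num => //; exact: integrable_funeneg.
have fin_inv (x : \bar R) : (`|\det A|%:E * x)%E \is a fin_num -> x \is a fin_num.
  move: x => [x //||].
    by rewrite gt0_muley// lte_fin lt_neqAle eq_sym d0 /=.
  by rewrite gt0_muleNy// lte_fin lt_neqAle eq_sym d0 /=.
have pfin := fin_inv _ (etrans (congr1 (fun x => x \is a fin_num) Ep) Pfin).
have nfin := fin_inv _ (etrans (congr1 (fun x => x \is a fin_num) En) Nfin).
have E : (`|\det A|%:E * \int[muV]_v (EFin \o g) (A *m v) = \int[muV]_v (EFin \o g) v)%E.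
  rewrite [in LHS]integralE [in RHS]integralE -Ep -En.
  have -> : (\int[muV]_v ((fun v => (EFin \o g) (A *m v))^\+ v))%E =
            (\int[muV]_v ((EFin \o g)^\+ (A *m v)))%E.
    by rewrite (funepos_comp (EFin \o g) (fun v => A *m v)).
  have -> : (\int[muV]_v ((fun v => (EFin \o g) (A *m v))^\- v))%E =
            (\int[muV]_v ((EFin \o g)^\- (A *m v)))%E.
    by rewrite (funeneg_comp (EFin \o g) (fun v => A *m v)).
  by rewrite muleBr// fin_num_adde_defl// fin_numN.
rewrite -[LHS]/(`|\det A| * fine (\int[muV]_v (EFin \o g) (A *m v))%E) /Rintegral -E fineM//.
by rewrite fin_inv// E; exact: integrable_fin_num.
Qed.

Section spectral_covariance.
Variable R : realType.

Lemma normr_sin_le (t : R) : `|sin t| <= `|t|.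
Proof.
wlog t0 : t / 0 <= t.
  move=> h; have [/h //|t0] := leP 0 t.
  by have := h (- t); rewrite sinN !normrN; apply; rewrite oppr_ge0 ltW.
have csin : {within `[0, t], continuous (@sin R)}.
  by apply: continuous_subspaceT => x; exact: continuous_sin.
have [c _] := MVT_segment t0 (fun x _ => is_derive_sin x) csin.
rewrite sin0 !subr0 => ->; rewrite normrM ler_piMl//; exact: cos_max.
Qed.

Lemma one_subr_cos_le (t : R) : 1 - cos t <= t ^+ 2.
Proof.
have -> : 1 - cos t = 2 * sin (t / 2) ^+ 2.
  rewrite [in LHS](splitr t) cosD -!expr2; have := cos2Dsin2 (t / 2).
  by move: (cos _) (sin _) => a b; lra.
have : sin (t / 2) ^+ 2 <= (t / 2) ^+ 2.
  rewrite -[leLHS]real_normK ?num_real// -[leRHS]real_normK ?num_real//.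
  by rewrite lerXn2r ?nnegrE// normr_sin_le.
by have := sqr_ge0 t; nra.
Qed.

Lemma normr_dotv_le n (x y : 'cV[R]_n) :
  `|dotv x y| <= (\sum_i `|x i ord0|) * Num.sqrt (dotv y y).
Proof.
rewrite (le_trans (ler_norm_sum _ _ _))// mulr_suml; apply: ler_sum => i _.
rewrite normrM ler_wpM2l// -[leLHS]ger0_norm// -sqrtr_sqr ler_sqrt.
  by rewrite real_normK ?num_real// /dotv (bigD1 i)//= expr2 lerDl sumr_ge0// => j _; rewrite -expr2 sqr_ge0.
exact: dotv_ge0.
Qed.

(** The real part of [(exp(i a) - 1) (exp(- i b) - 1)]. *)
Definition cov_kernel (a b : R) := cos (a - b) - cos a - cos b + 1.

Lemma spectral_covarianceE n (f : 'cV[R]_n -> R) x y :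
  spectral_covariance f x y =
  \int[lebesgue_cV R n]_xi (cov_kernel (dotv x xi) (dotv y xi) * f xi).
Proof.
rewrite /spectral_covariance /cintegral /=; apply: eq_Rintegral => xi _.
rewrite /expi /= /cov_kernel cosB cosN sinN; simpc => /=.
by ring.
Qed.

(** The kernel is the inner product of [(cos a - 1, sin a)] and [(cos b - 1, sin b)], whose squared
    lengths are [2 (1 - cos a)] and [2 (1 - cos b)]; the bound is [2 |<u, v>| <= |u|^2 + |v|^2]. *)
Lemma normr_cov_kernel_le a b : `|cov_kernel a b| <= (1 - cos a) + (1 - cos b).
Proof.
have -> : cov_kernel a b = (cos a - 1) * (cos b - 1) + sin a * sin b.
  by rewrite /cov_kernel cosB; ring.
have := cos2Dsin2 a; have := cos2Dsin2 b.
move: (cos a) (sin a) (cos b) (sin b) => u v p q h1 h2.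
by rewrite ler_norml; apply/andP; split;
  [have := sqr_ge0 ((u - 1) + (p - 1)); have := sqr_ge0 (v + q)
  |have := sqr_ge0 ((u - 1) - (p - 1)); have := sqr_ge0 (v - q)]; nra.
Qed.

Lemma integrable_cov_kernel n (f : 'cV[R]_n -> R) x y :
  spectral_density f -> (forall xi, 0 <= f xi) ->
  (lebesgue_cV R n).-integrable setT
    (EFin \o (fun xi => cov_kernel (dotv x xi) (dotv y xi) * f xi)).
Proof.
move=> [mf _ fint] f0.
pose g xi := Num.min 1 (dotv xi xi) * f xi.
have g0 xi : 0 <= g xi by rewrite mulr_ge0// le_min ler01 dotv_ge0.
have mg : measurable_fun [set: 'cV[R]_n] (EFin \o g).
  apply/measurable_EFinP; apply: measurable_funM => //.
  apply: measurable_minr => //; apply: measurable_sum => i.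
  by apply: measurable_funM; exact: measurable_mx_entry.
have ig : (lebesgue_cV R n).-integrable setT (EFin \o g).
  apply/integrableP; split=> //; apply: le_lt_trans fint.
  by under eq_integral do rewrite /= ger0_norm//.
(* The 2 bounds [1 - cos] where [dotv xi xi >= 1]; elsewhere [1 - cos t <= t ^+ 2] and a
   Cauchy-Schwarz type bound give the square. *)
pose K (z : 'cV[R]_n) := 2 + (\sum_i `|z i ord0|) ^+ 2.
have K0 z : 0 <= K z by rewrite addr_ge0// sqr_ge0.
have cosK z xi : 1 - cos (dotv z xi) <= K z * Num.min 1 (dotv xi xi).
  rewrite /K; have [h|h] := leP 1 (dotv xi xi).
    have := cos_geN1 (dotv z xi); have := sqr_ge0 (\sum_i `|z i ord0|); lra.
  apply: le_trans (one_subr_cos_le _) _.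
  apply: (@le_trans _ _ ((\sum_i `|z i ord0|) ^+ 2 * dotv xi xi)).
    rewrite -[leLHS]real_normK ?num_real// -[X in _ <= _ * X]sqr_sqrtr ?dotv_ge0// -exprMn.
    by rewrite lerXn2r ?nnegrE ?mulr_ge0 ?sumr_ge0 ?sqrtr_ge0// normr_dotv_le.
  by rewrite mulrDl lerDr mulr_ge0 ?dotv_ge0.
apply: (le_integrable measurableT _ _ (integrableZl measurableT (K x + K y) ig)).
  apply/measurable_EFinP; apply: measurable_funM => //; rewrite /cov_kernel.
  have mc z : measurable_fun [set: 'cV[R]_n] (fun xi => cos (dotv z xi)).
    by apply: (measurableT_comp (continuous_measurable_fun (@continuous_cos R))); exact: measurable_dotv.
  apply: measurable_funD => //; apply: measurable_funB => //; apply: measurable_funB => //.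
  by under eq_fun do rewrite -dotvNl -dotvDl; exact: mc.
move=> xi _; rewrite /= lee_fin normrM (ger0_norm (f0 xi)) [leRHS]ger0_norm; last first.
  by rewrite mulr_ge0// addr_ge0.
rewrite /g mulrA ler_wpM2r// (le_trans (normr_cov_kernel_le _ _))// mulrDl.
by rewrite lerD// cosK.
Qed.

(** The left-hand side is the bilinear expansion of the covariance of [X (x + h) - X h] and
    [X (y + h) - X h]. *)
Lemma spectral_covariance_increments n (f : 'cV[R]_n -> R) x y h :
  spectral_density f -> (forall xi, 0 <= f xi) ->
  spectral_covariance f (x + h) (y + h) - spectral_covariance f (x + h) h -
  (spectral_covariance f h (y + h) - spectral_covariance f h h) =
  spectral_covariance f x y.
Proof.
move=> sf f0; rewrite !spectral_covarianceE.
have ik u v := integrable_cov_kernel u v sf f0.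
have ikB u v u' v' := integrableB measurableT (ik u v) (ik u' v').
rewrite -!RintegralB//; [|exact: ikB..].
apply: eq_Rintegral => xi _; rewrite -!mulrBl; congr (_ * _).
rewrite /cov_kernel !dotvDl !subrr.
have -> : dotv x xi + dotv h xi - dotv h xi = dotv x xi by ring.
have -> : dotv h xi - (dotv y xi + dotv h xi) = - dotv y xi by ring.
have -> : dotv x xi + dotv h xi - (dotv y xi + dotv h xi) = dotv x xi - dotv y xi by ring.
by rewrite cosN cos0; ring.
Qed.

Lemma dotv_mulmxl n (A : 'M[R]_n) (x y : 'cV[R]_n) : dotv (A *m x) y = dotv x (A^T *m y).
Proof.
have dotvE (u v : 'cV[R]_n) : dotv u v = (u^T *m v) ord0 ord0.
  by rewrite mxE; apply: eq_bigr => i _; rewrite mxE.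
by rewrite !dotvE trmx_mul mulmxA.
Qed.

Lemma spectral_covariance_scaling n (A : 'M[R]_n) (f : 'cV[R]_n -> R) (b : R) x y :
  spectral_density f -> (forall xi, 0 <= f xi) -> A \in unitmx -> b != 0 ->
  (forall xi, f xi = b * f (A^T *m xi)) ->
  spectral_covariance f (A *m x) (A *m y) = b / `|\det A| * spectral_covariance f x y.
Proof.
move=> sf f0 uA b0 fA; rewrite !spectral_covarianceE.
have uAt : A^T \in unitmx by rewrite unitmx_tr.
have ik := integrable_cov_kernel x y sf f0.
have d0 : `|\det A| != 0 by rewrite normr_eq0 -unitfE -unitmxE.
rewrite -(Rintegral_linear_substitution uAt ik) det_tr mulrA divfK//.
have E xi : cov_kernel (dotv (A *m x) xi) (dotv (A *m y) xi) * f xi =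
    b * (cov_kernel (dotv x (A^T *m xi)) (dotv y (A^T *m xi)) * f (A^T *m xi)).
  by rewrite !dotv_mulmxl fA mulrCA.
rewrite -RintegralZl//; first by apply: eq_Rintegral => xi _; exact: E.
have /= := integrableZl measurableT b^-1 (integrable_cov_kernel (A *m x) (A *m y) sf f0).
by under eq_fun do rewrite E -EFinM mulKf//.
Qed.

End spectral_covariance.

(** * Finite-dimensional laws from covariances *)

Section gaussian_process.
Variables (R : realType) (d : measure_display) (T : measurableType d).
Variables (Pr : probability T R) (n : nat).
Implicit Types Y : 'cV[R]_n -> T -> R.

(** Plain functions instead of random variables, so that increments, rescalings and linear
    substitutions of the field all fit. *)
Definition centered_gaussian_process Y :=
  [/\ forall k (x : 'I_k -> 'cV[R]_n) (c : 'I_k -> R),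
        gaussian_rv Pr (fun w => \sum_i c i * Y (x i) w),
      forall x, square_integrable Pr (Y x) &
      forall x, \int[Pr]_w Y x w = 0].

Let Prfin : (Pr setT < +oo)%E.
Proof. by rewrite probability_setT ltry. Qed.

Lemma Rintegral_sum (I : Type) (r : seq I) (F : I -> T -> R) :
  (forall i, Pr.-integrable setT (EFin \o F i)) ->
  Pr.-integrable setT (EFin \o (fun w => \sum_(i <- r) F i w)) /\
  \int[Pr]_w (\sum_(i <- r) F i w) = \sum_(i <- r) \int[Pr]_w F i w.
Proof.
move=> iF; elim: r => [|i r [ir IH]].
  have -> : (fun w => \sum_(i <- [::]) F i w) = fun=> 0.
    by apply/funext => w; rewrite big_nil.
  by split; [exact: integrable0|rewrite big_nil Rintegral_cst// mul0r].
have -> : (fun w => \sum_(j <- i :: r) F j w) = fun w => F i w + \sum_(j <- r) F j w.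
  by apply/funext => w; rewrite big_cons.
have iD := integrableD measurableT (iF i) ir.
by split; [exact: iD|rewrite big_cons RintegralD// IH].
Qed.

Lemma second_moment_sum k (x : 'I_k -> 'cV[R]_n) (c : 'I_k -> R) Y :
  centered_gaussian_process Y ->
  \int[Pr]_w (\sum_i c i * Y (x i) w) ^+ 2 =
  \sum_i \sum_j c i * c j * \int[Pr]_w (Y (x i) w * Y (x j) w).
Proof.
move=> [_ sqY _].
have ij i j := square_integrableM (sqY (x i)) (sqY (x j)).
have icc i j : Pr.-integrable setT (EFin \o (fun w => c i * c j * (Y (x i) w * Y (x j) w))).
  by have iZ := integrableZl measurableT (c i * c j) (ij i j); exact: iZ.
transitivity (\int[Pr]_w (\sum_i \sum_j c i * c j * (Y (x i) w * Y (x j) w))).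
  apply: eq_Rintegral => w _; rewrite expr2 mulr_suml; apply: eq_bigr => i _.
  by rewrite mulr_sumr; apply: eq_bigr => j _; rewrite mulrACA.
rewrite (Rintegral_sum _ (fun i => (Rintegral_sum _ (icc i)).1)).2.
apply: eq_bigr => i _; rewrite (Rintegral_sum _ (icc i)).2.
by apply: eq_bigr => j _; rewrite RintegralZl.
Qed.

Lemma centered_gaussian_process_eq_fdd Y1 Y2 :
  centered_gaussian_process Y1 -> centered_gaussian_process Y2 ->
  (forall x y, \int[Pr]_w (Y1 x w * Y1 y w) = \int[Pr]_w (Y2 x w * Y2 y w)) ->
  eq_fdd Pr Y1 Y2.
Proof.
move=> gY1 gY2 cov k x.
have mY Y : centered_gaussian_process Y ->
    measurable_fun setT (fun w => \col_i Y (x i) w : 'cV[R]_k).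
  move=> [_ sqY _]; apply/measurable_fun_mxP => i j.
  by under eq_fun do rewrite mxE; have [] := sqY (x i).
pose law Y (gY : centered_gaussian_process Y) :=
  measure_function_pushforward__canonical__measure_function_Measure Pr (mY Y gY).
have lawfin Y gY : (law Y gY setT < +oo)%E by rewrite /law/= /pushforward preimage_setT.
apply: (cramer_wold (lawfin _ gY1) (lawfin _ gY2)) => c A mA.
have dotE Y : (fun w => dotv c (\col_i Y (x i) w)) = fun w => \sum_i c i ord0 * Y (x i) w.
  by apply/funext => w; apply: eq_bigr => i _; rewrite mxE.
have sq Y : centered_gaussian_process Y -> square_integrable Pr (fun w => \sum_i c i ord0 * Y (x i) w).
  by move=> [_ sqY _]; apply: square_integrable_sum => // i; exact: square_integrableZ.
have mean0 Y : centered_gaussian_process Y -> \int[Pr]_w (\sum_i c i ord0 * Y (x i) w) = 0.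
  move=> [_ sqY mY0].
  have iY i := square_integrable_integrable Prfin (sqY (x i)).
  have icY i : Pr.-integrable setT (EFin \o (fun w => c i ord0 * Y (x i) w)).
    by have iZ := integrableZl measurableT (c i ord0) (iY i); exact: iZ.
  rewrite (Rintegral_sum _ icY).2 big1// => i _.
  by rewrite RintegralZl// mY0 mulr0.
have lawE Y gY : law Y gY (dotv c @^-1` A) = Pr ((fun w => \sum_i c i ord0 * Y (x i) w) @^-1` A).
  by rewrite -dotE.
rewrite !lawE.
case: (gY1) (gY2) => [g1 _ _] [g2 _ _].
apply: (gaussian_rv_same_law (g1 k x _) (g2 k x _) (sq _ gY1) (sq _ gY2) (mean0 _ gY1) (mean0 _ gY2)) => //.
rewrite !second_moment_sum//.
by apply: eq_bigr => i _; apply: eq_bigr => j _; rewrite cov.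
Qed.

End gaussian_process.

(** * Invariance properties of the field *)

Section gaussian_field_with_density.
Variables (R : realType) (d : measure_display) (T : measurableType d).
Variables (Pr : probability T R) (n : nat) (X : 'cV[R]_n -> {RV Pr >-> R}).
Variable f : 'cV[R]_n -> R.
Hypotheses (Xf : gaussian_field_with_density X f) (sf : spectral_density f).
Hypothesis f0 : forall xi, 0 <= f xi.

Let Prfin : (Pr setT < +oo)%E.
Proof. by rewrite probability_setT ltry. Qed.

Lemma field_covariance x y : \int[Pr]_w (X x w * X y w) = spectral_covariance f x y.
Proof. by have [_ _ /(_ x y)] := Xf; rewrite unlock /Rintegral => ->. Qed.

Lemma field_centered_gaussian_process : centered_gaussian_process Pr (fun x => X x).
Proof.
have [gX mX cX] := Xf; split=> [//|x|x].
  split; first exact: measurable_funPT.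
  apply/integrableP; split.
    by apply/measurable_EFinP; apply: measurable_funX; exact: measurable_funPT.
  have := cX x x; rewrite unlock => e.
  under eq_integral do rewrite /= ger0_norm ?sqr_ge0// expr2.
  by rewrite e ltry.
by have := mX x; rewrite unlock /Rintegral => ->.
Qed.

Lemma field_stationary_increments : stationary_increments X.
Proof.
move=> h; have gpX := field_centered_gaussian_process; have [gX sqX mX] := gpX.
have iX x := square_integrable_integrable Prfin (sqX x).
have sqN a x : square_integrable Pr (fun w => a * X x w) by exact: square_integrableZ.
apply: centered_gaussian_process_eq_fdd gpX _ => [|x y].
  split=> [k x c|x|x].
  (* A combination of [k] increments is one of [k + 1] values of [X]: index 0 carries the point [h]
     with coefficient [- \sum_j c j]. *)
  - pose x' (i : 'I_k.+1) := oapp (fun j => x j + h) h (unlift ord0 i).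
    pose c' (i : 'I_k.+1) := oapp c (- \sum_j c j) (unlift ord0 i).
    have := gX k.+1 x' c'; congr gaussian_rv; apply/funext => w.
    rewrite big_ord_recl /x' /c' unlift_none /= mulNr mulr_suml addrC -sumrB.
    by apply: eq_bigr => i _; rewrite liftK /= mulrBr.
  - have := square_integrableD (sqX (x + h)) (sqN (-1) h).
    by congr square_integrable; apply/funext => w; rewrite mulN1r.
  - by rewrite RintegralB// !mX subr0.
have E a b := square_integrableM (sqX a) (sqX b).
rewrite field_covariance -(spectral_covariance_increments x y h sf f0) -!field_covariance.
have EB a b a' b' := integrableB measurableT (E a b) (E a' b').
rewrite -!RintegralB//; [|exact: EB..].
by apply: eq_Rintegral => w _; ring.
Qed.

(** In the covariance of [X (A *m x)], the factor [|\det A|] in the homogeneity of [f] absorbs the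
    Jacobian and leaves [b ^+ 2]. The intended case is [A = a^E], [b = a^H]. *)
Lemma field_linear_scaling (A : 'M[R]_n) (b : R) :
  A \in unitmx -> 0 < b -> (forall xi, f xi = b ^+ 2 * `|\det A| * f (A^T *m xi)) ->
  eq_fdd Pr (fun x => X (A *m x)) (fun x w => b * X x w).
Proof.
move=> uA b0 fA; have gpX := field_centered_gaussian_process; have [gX sqX mX] := gpX.
have iX x := square_integrable_integrable Prfin (sqX x).
have d0 : `|\det A| != 0 by rewrite normr_eq0 -unitfE -unitmxE.
apply: centered_gaussian_process_eq_fdd => [||x y].
- by split=> [k x c|x|x]; [exact: gX|exact: sqX|exact: mX].
- split=> [k x c|x|x].
  + have := gX k x (fun i => c i * b); congr gaussian_rv; apply/funext => w.
    by apply: eq_bigr => i _; rewrite mulrA.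
  + exact: square_integrableZ.
  + by rewrite RintegralZl// mX mulr0.
rewrite field_covariance (spectral_covariance_scaling _ _ sf f0 uA _ fA); last first.
  by rewrite mulf_neq0// expf_neq0// gt_eqF.
rewrite mulfK// -field_covariance.
have iXX := square_integrableM (sqX x) (sqX y).
by rewrite -RintegralZl//; apply: eq_Rintegral => w _; rewrite expr2 mulrACA.
Qed.

End gaussian_field_with_density.

Theorem proposition3p4 (R : realType) (m1 m2 : nat)
    (dim : 'I_(m1 + m2) -> nat) (E P : 'M[R]_(\sum_l dim l))
    (B : forall l, 'M[R]_(dim l)) (tau : forall l, 'cV[R]_(dim l) -> R)
    (posE : positive_spectrum E)
    (jordanE : real_jordan_reduction E P B)
    (tauP : forall l, pseudo_norm (B l)^T (tau l)) :
  let phi := fun xi : 'cV[R]_(\sum_l dim l) =>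
    Num.sqrt (\sum_l tau l (submxcol xi l) ^+ 2) in
  let rho := fun xi => phi (P^T *m xi) in
  pseudo_norm E^T rho /\
  forall H : R, 0 < H -> H < lambda_min E ->
    let f := fun xi => rho xi `^ (- (2 * H + \tr E)) in
    spectral_density f /\
    forall (disp : measure_display) (T : measurableType disp)
      (Pr : probability T R) (X : 'cV[R]_(\sum_l dim l) -> {RV Pr >-> R}),
      gaussian_field_with_density X f ->
      stationary_increments X /\ operator_scaling X E H.
Proof.
move=> phi rho; have pn : pseudo_norm E^T rho by exact: jordan_pseudo_norm posE jordanE tauP.
split=> // H H0 HE f.
have n0 : (0 < \sum_l dim l)%N.
  have [[m0 d0] _ _ _ _] := jordanE.
  by rewrite (bigD1 (Ordinal m0))//= ltn_addr.
have sf : spectral_density f.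
  rewrite /f -mxtrace_tr; apply: (spectral_density_pseudo_norm n0 pn H0 HE) => z.
  (* An infimum in [R] bounds its set from below only when that set has a lower bound; here 0 is
     one, by positivity of the spectrum. *)
  rewrite complex_spectrum_tr => Ez; apply: ge_inf; last by exists z.
  by exists 0 => _ [y Ey <-]; exact/ltW/posE.
have f0 xi : 0 <= f xi by exact: powR_ge0.
split=> // disp T Pr X Xf; split; first exact: field_stationary_increments Xf sf f0.
move=> a a0.
have detA : \det (mxpow a E) = a `^ \tr E.
  by rewrite det_mxexp linearZ /= /powR gt_eqF// mulrC.
have [_ _ _ rhoZ] := pn.
apply: (field_linear_scaling Xf sf f0); last 1 first.
(* Homogeneity of [rho] produces [a^(- 2 H - Tr E)], which cancels the factors [a^(2 H)] and
   [det (a^E) = a^(Tr E)]. *)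
- move=> xi; rewrite detA ger0_norm ?powR_ge0//.
  have -> : (mxpow a E)^T = mxpow a E^T by rewrite /mxpow -mxexp_tr linearZ.
  have r0 : 0 <= rho xi by exact: pseudo_norm_ge0 pn.
  rewrite /f rhoZ// (powRM _ (ltW a0) r0) mulrA.
  rewrite -powR_mulrn ?powR_ge0// -powRrM -!powRD ?(gt_eqF a0) ?implybT//.
  by rewrite (mulrC H) subrr powRr0 mul1r.
- by rewrite unitmxE detA unitfE gt_eqF// powR_gt0.
- exact: powR_gt0.
Qed.
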